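(* Any mildly mixing (hence weakly mixing) measure preserving transformation $T$ on a separable probability space $(X,\mathcal{B},\mu)$ has a realization that is lightly mixing on intervals, and as a consequence this realization is topologically mixing. More precisely, let $\lambda$ be Lebesgue measure on $[0,1)$. There exist a dense algebra $\mathcal{C}\subset\mathcal{B}$ such that $T$ is lightly mixing on $\mathcal{C}$, and an invertible measure space isomorphism $\phi:[0,1)\to X$ between $([0,1),\lambda)$ and $(X,\mu)$ such that for any interval $I\subset[0,1)$ the set $\phi(I)$ contains an element from $\mathcal{C}$. Hence the transformation $\phi^{-1}\circ T\circ\phi$ is mildly mixing and lightly mixing on intervals.
   Context: A transformation on a separable probability space $(X,\mathcal{B},\mu)$ is a measurable and invertible map $T:X\to X$; it is measure preserving if $\mu(T^{-1}A)=\mu(A)$ for each $A\in\mathcal{B}$. $\mathcal{B}$ is considered as a separable metric space with the distance $d(A,B)=\mu(A\triangle B)$, and dense means dense for $d$. A measure preserving transformation $R$ on $(Y,\mathcal{E},\nu)$ is a factor of $T$ if there is a measurable $\pi:X\to Y$ with $\mu(\pi^{-1}E)=\nu(E)$ for all $E\in\mathcal{E}$ and $\pi\circ T=R\circ\pi$ almost everywhere; it is trivial if $\nu(E)\in\{0,1\}$ for all $E\in\mathcal{E}$. $R$ is rigid if there is a sequence of integers $n_k\to\infty$ with $\nu(R^{n_k}E\triangle E)\to0$ for all $E\in\mathcal{E}$. $T$ is mildly mixing if it has no (nontrivial) rigid factor. $T$ is lightly mixing on a collection of measurable sets if $\liminf_{n\to\infty}\mu(T^nA\cap B)>0$ for all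 $A,B$ in the collection having positive measure; lightly mixing on intervals means lightly mixing (with respect to $\lambda$) on the collection of intervals in $[0,1)$. A transformation $S$ of $([0,1),\lambda)$ is topologically mixing if for any two (nonempty) open sets $U,V$ there exists $N$ such that $\lambda(S^nU\cap V)>0$ for all $n\ge N$.
   Formalization: The separable probability space is also assumed standard Borel and not trivial (some set has measure strictly between 0 and 1), since otherwise no isomorphism with [0,1) need exist; intervals are of positive length; the remark ''hence weakly mixing'' is not included. *)

(* Defs.v *)
From HB Require Import structures.
From mathcomp Require Import all_boot all_order all_algebra.
From mathcomp Require Import all_classical all_reals all_analysis.
Import Order.TTheory GRing.Theory Num.Theory.
Import numFieldNormedType.Exports.

Set Implicit Arguments.
Unset Strict Implicit.
Unset Printing Implicit Defensive.

Local Open Scope classical_set_scope.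
Local Open Scope ring_scope.

(* The interval [0, 1[ as a type, with the subspace topology and the Borel
   sigma-algebra induced from R. *)
Definition I01 (R : realType) : Type := [set` `[0 : R, 1[].

Definition I01_val (R : realType) : I01 R -> R := set_val.

Section I01_structure.
Variable R : realType.

HB.instance Definition _ := Topological.copy (I01 R) [set` `[0 : R, 1[].

Let I01_0_subproof : (0 : R) \in [set` `[0 : R, 1[].
Proof. by rewrite inE /= in_itv /= lexx ltr01. Qed.

HB.instance Definition _ :=
  isPointed.Build (I01 R) (exist _ 0 I01_0_subproof).

HB.instance Definition _ :=
  Measurable.copy (I01 R) (g_sigma_algebra_preimageType (@I01_val R)).

End I01_structure.

(* Lebesgue measure on [0, 1[. *)
Definition lebesgue01 (R : realType) (A : set (I01 R)) : \bar R :=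
  lebesgue_measure (@I01_val R @` A).

Section lebesgue01_probability.
Variable R : realType.

Let val_inj01 : injective (@I01_val R).
Proof. exact: val_inj. Qed.

Let measurable_image01 (A : set (I01 R)) :
  measurable A -> measurable (@I01_val R @` A).
Proof.
case=> B mB <-; rewrite setTI.
have -> : @I01_val R @` (@I01_val R @^-1` B) = [set` `[0 : R, 1[] `&` B.
  apply/seteqP; split => [_ [x Bx <-]|x [x01 Bx]].
    by split => //; exact: (@set_valP _ _ x).
  by exists (exist _ x (mem_set x01)).
exact: measurableI.
Qed.

Let lebesgue01_0 : @lebesgue01 R set0 = 0%E.
Proof. by rewrite /lebesgue01 image_set0 measure0. Qed.

Let lebesgue01_ge0 A : (0 <= @lebesgue01 R A)%E.
Proof. exact: measure_ge0. Qed.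

Let lebesgue01_semi_sigma_additive : semi_sigma_additive (@lebesgue01 R).
Proof.
move=> F mF tF mUF; rewrite /lebesgue01 image_bigcup.
apply: measure_semi_sigma_additive.
- by move=> n; exact: measurable_image01.
- move=> i j _ _ [_ [[a Fia <-] [b Fjb /val_inj01 ba]]].
  by apply: tF => //; exists a; split => //; rewrite -ba.
- by rewrite -image_bigcup; exact: measurable_image01.
Qed.

HB.instance Definition _ := isMeasure.Build _ _ _ (@lebesgue01 R)
  lebesgue01_0 lebesgue01_ge0 lebesgue01_semi_sigma_additive.

Let lebesgue01_setT : @lebesgue01 R setT = 1%E.
Proof.
rewrite /lebesgue01.
have -> : @I01_val R @` setT = [set` `[0 : R, 1[].
  apply/seteqP; split => [_ [x _ <-]|x x01]; first exact: (@set_valP _ _ x).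
  by exists (exist _ x (mem_set x01)).
by rewrite lebesgue_measure_itv /= lte_fin ltr01 oppr0 adde0.
Qed.

HB.instance Definition _ :=
  Measure_isProbability.Build _ _ _ (@lebesgue01 R) lebesgue01_setT.

End lebesgue01_probability.

(* All intervals contained in [0, 1[, whether open, closed or half-open; empty
   and one-point intervals are included. *)
Definition intervals01 (R : realType) : set (set (I01 R)) :=
  [set J | is_interval (@I01_val R @` J)].

(* Density for the pseudometric d(A, B) = mu (A `+` B), A and B measurable. *)
Definition dense_family d (X : measurableType d) (R : realType)
    (mu : probability X R) (C : set (set X)) : Prop :=
  C `<=` measurable /\
  forall A, measurable A -> forall e : R, 0 < e ->
    exists2 B, C B & (mu (A `+` B) < e%:E)%E.

Definition separable_space d (X : measurableType d) (R : realType)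
    (mu : probability X R) : Prop :=
  exists2 D : set (set X), countable D & dense_family mu D.

(* Borel isomorphic to a Borel subset of the real line. *)
Definition standard_Borel d (X : measurableType d) (R : realType) : Prop :=
  exists f : X -> R, [/\ measurable_fun setT f, injective f &
    forall A, measurable A -> measurable (f @` A)].

Definition trivial_space d (X : measurableType d) (R : realType)
    (mu : probability X R) : Prop :=
  forall A, measurable A -> mu A = 0%E \/ mu A = 1%E.

Definition set_algebra (X : Type) (C : set (set X)) : Prop :=
  setring C /\ C setT.

Definition inverse_measurable d1 d2 (X : measurableType d1)
    (Y : measurableType d2) (f : X -> Y) (g : Y -> X) : Prop :=
  [/\ cancel f g, cancel g f, measurable_fun setT f & measurable_fun setT g].

(* The inverse is required to be measurable, so that the images of measurable
   sets under iterates of T are measurable. *)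
Definition transformation d (X : measurableType d) (T : X -> X) : Prop :=
  exists T' : X -> X, inverse_measurable T T'.

Definition measure_preserving d1 d2 (X : measurableType d1)
    (Y : measurableType d2) (R : realType) (mu : probability X R)
    (nu : probability Y R) (f : X -> Y) : Prop :=
  forall A, measurable A -> mu (f @^-1` A) = nu A.

Definition mp_transformation d (X : measurableType d) (R : realType)
    (mu : probability X R) (T : X -> X) : Prop :=
  transformation T /\ measure_preserving mu mu T.

Definition measure_isomorphism d1 d2 (X : measurableType d1)
    (Y : measurableType d2) (R : realType) (mu : probability X R)
    (nu : probability Y R) (f : X -> Y) (g : Y -> X) : Prop :=
  inverse_measurable f g /\ measure_preserving mu nu f.

Definition is_factor d1 d2 (X : measurableType d1) (Y : measurableType d2)
    (R : realType) (mu : probability X R) (T : X -> X)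
    (nu : probability Y R) (S : Y -> Y) : Prop :=
  exists pi : X -> Y, [/\ measurable_fun setT pi, measure_preserving mu nu pi &
    {ae mu, forall x, pi (T x) = S (pi x)}].

Definition rigid d (X : measurableType d) (R : realType)
    (mu : probability X R) (T : X -> X) : Prop :=
  exists2 n : nat -> nat, n @ \oo --> \oo &
    forall E, measurable E ->
      (fun k => mu ((iter (n k) T @` E) `+` E)) @ \oo --> 0%E.

Definition mildly_mixing d (X : measurableType d) (R : realType)
    (mu : probability X R) (T : X -> X) : Prop :=
  forall d' (Y : measurableType d') (nu : probability Y R) (S : Y -> Y),
    separable_space nu -> mp_transformation nu S ->
    is_factor mu T nu S -> rigid nu S -> trivial_space nu.

Definition lightly_mixing_on d (X : measurableType d) (R : realType)
    (mu : probability X R) (C : set (set X)) (T : X -> X) : Prop :=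
  forall A B, C A -> C B -> (0 < mu A)%E -> (0 < mu B)%E ->
    (0 < limn_einf (fun n => mu ((iter n T @` A) `&` B)))%E.

Definition topologically_mixing01 (R : realType) (S : I01 R -> I01 R) : Prop :=
  forall U V : set (I01 R), open U -> open V -> U !=set0 -> V !=set0 ->
    exists N, forall n, (N <= n)%N ->
      (0 < @lebesgue01 R ((iter n S @` U) `&` V))%E.

(* Main.v *)
From HB Require Import structures.
Require Import Defs.
From mathcomp Require Import all_boot all_order all_algebra.
From mathcomp Require Import all_classical all_reals all_analysis.
From mathcomp Require Import measurable_realfun lra.
Import Order.TTheory GRing.Theory Num.Theory.
Import numFieldNormedType.Exports.

Set Implicit Arguments.
Unset Strict Implicit.
Unset Printing Implicit Defensive.

Local Open Scope classical_set_scope.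
Local Open Scope ring_scope.

(** The construction uses mild mixing only in [mild_mixing_escape]: if 0 < mu A < 1,
    then mu (T^n A \ A) stays away from 0 for large n.  Indeed, along a sequence of
    times at which this measure tends to 0, the sets that are asymptotically
    invariant form an invariant sub-sigma-algebra, hence a rigid factor.

    This fact produces arbitrarily small disjoint sets N and C such that
    mu (T^n N & C) stays away from 0 ([small_light_pair]).  Take a base B with
    B, T B, .., T^(h-1) B disjoint, and let the level of a point be the time
    elapsed since its last visit to B.  Let C consist of the levels that are
    positive multiples of r, and N of the levels below 2 r other than r.  If x is
    in B and y is not, their levels differ, and a comparison of the next 2 r
    levels of x and y shows that at some time x is in N while y is in C.  Since B
    escapes from itself, such pairs x = T^(-n) y have a measure that is bounded
    from below.  If h is large with respect to r, and r is large, both sets are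
    small.

    Choosing such pairs successively, each much smaller than the light mixing
    constants of the previous ones, and removing the later pairs from the earlier
    ones, gives countably many disjoint pairs ([disjoint_light_pairs]).  Now X is
    embedded into the real line in such a way that every pair of intervals
    receives one of these pairs ([embedding_into_cells]): a Cantor set of numbers
    with base four digits 0 and 1 is copied disjointly into countably many
    prescribed intervals.  The distribution function of the embedding turns it
    into an isomorphism with Lebesgue measure on [0, 1[, up to null sets that are
    repaired by a measurable Cantor-Bernstein argument ([atomless_isomorphism]).
    As the distribution function is monotone, the preimage of a nondegenerate
    interval of [0, 1[ still contains, up to a null set, the preimage of an
    interval of the line.  Hence any two nondegenerate intervals form a lightly
    mixing pair, and the finite unions of intervals are the required algebra. *)

(** * Probabilities as real numbers *)

Section real_valued_probability.
Context d (X : measurableType d) (R : realType) (mu : probability X R).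

Definition prob (A : set X) : R := fine (mu A).

Lemma probE A : measurable A -> mu A = (prob A)%:E.
Proof. by move=> mA; rewrite /prob fineK// fin_num_measure. Qed.

Lemma prob_ge0 A : 0 <= prob A.
Proof. by rewrite /prob fine_ge0// measure_ge0. Qed.

Lemma prob_set0 : prob set0 = 0.
Proof. by rewrite /prob measure0. Qed.

Lemma prob_setT : prob setT = 1.
Proof. by rewrite /prob probability_setT. Qed.

Lemma prob_le A B : measurable A -> measurable B -> A `<=` B ->
  prob A <= prob B.
Proof.
move=> mA mB AB; rewrite -lee_fin -!probE//.
by apply: le_measure => //; rewrite inE.
Qed.

Lemma prob_le1 A : measurable A -> prob A <= 1.
Proof. by move=> mA; rewrite -prob_setT; apply: prob_le. Qed.

Lemma probDI A B : measurable A -> measurable B ->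
  prob A = prob (A `\` B) + prob (A `&` B).
Proof.
move=> mA mB; apply: EFin_inj; rewrite EFinD -!probE//.
- by rewrite -measureDI.
- exact: measurableI.
- exact: measurableD.
Qed.

Lemma probU_le A B : measurable A -> measurable B ->
  prob (A `|` B) <= prob A + prob B.
Proof.
move=> mA mB; have mU := measurableU _ _ mA mB.
rewrite (probDI mU mB) setDUl setDv setU0.
have -> : (A `|` B) `&` B = B by apply/seteqP; split=> [x []|x Bx]//; split => //; right.
by rewrite lerD2r; apply: prob_le => //; exact: measurableD.
Qed.

Lemma probU A B : measurable A -> measurable B -> A `&` B = set0 ->
  prob (A `|` B) = prob A + prob B.
Proof.
move=> mA mB AB; apply: EFin_inj; rewrite EFinD -!probE//.
  by rewrite measureU.
exact: measurableU.
Qed.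

Lemma probC A : measurable A -> prob (~` A) = 1 - prob A.
Proof.
move=> mA; rewrite -prob_setT (probDI measurableT mA) setTD setTI; lra.
Qed.

Lemma prob_subD A B C : measurable A -> measurable B -> measurable C ->
  A `<=` B `|` C -> prob A <= prob B + prob C.
Proof.
move=> mA mB mC ABC; apply: le_trans (probU_le mB mC).
by apply: prob_le => //; exact: measurableU.
Qed.

Lemma prob0S A B : measurable A -> measurable B -> A `<=` B -> prob B = 0 ->
  prob A = 0.
Proof.
move=> mA mB AB B0; apply/eqP; rewrite eq_le prob_ge0 andbT -B0.
exact: prob_le.
Qed.

Lemma prob_bigsetU_le (F : nat -> set X) n : (forall i, measurable (F i)) ->
  prob (\big[setU/set0]_(i < n) F i) <= \sum_(i < n) prob (F i).
Proof.
move=> mF; elim: n => [|n ih]; first by rewrite !big_ord0 prob_set0.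
rewrite !big_ord_recr/= (le_trans (probU_le _ _))//.
  exact: bigsetU_measurable.
by rewrite lerD2r.
Qed.

Lemma prob_bigsetU (F : nat -> set X) n : (forall i, measurable (F i)) ->
  trivIset setT F ->
  prob (\big[setU/set0]_(i < n) F i) = \sum_(i < n) prob (F i).
Proof.
move=> mF tF; elim: n => [|n ih]; first by rewrite !big_ord0 prob_set0.
rewrite !big_ord_recr/= probU ?ih//.
  exact: bigsetU_measurable.
rewrite big_distrl/= big1// => i _; apply/eqP/contraT => /set0P[x xF].
have := tF i n I I (ex_intro _ x xF) => ieqn.
by have := ltn_ord i; rewrite ieqn ltnn.
Qed.

(** Continuity from below of the measure, applied to the partial unions. *)
Lemma prob_bigcup_tail (F : nat -> set X) (e : R) :
  (forall i, measurable (F i)) -> 0 < e ->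
  exists n, prob ((\bigcup_i F i) `\` \big[setU/set0]_(i < n) F i) < e.
Proof.
move=> mF e0; set U := \bigcup_i F i.
pose G n := \big[setU/set0]_(i < n.+1) F i.
have mG n : measurable (G n) by exact: bigsetU_measurable.
have mU : measurable U by exact: bigcupT_measurable.
have UG : U = \bigcup_n G n by rewrite /U bigcup_bigsetU_bigcup.
have cvgG : (mu \o G) @ \oo --> mu U.
  rewrite UG; apply: nondecreasing_cvg_mu => //.
    by rewrite -UG.
  by move=> m n mn; apply/subsetPset; exact: subset_bigsetU.
have cvgp : (prob \o G) @ \oo --> prob U.
  have : (fun n => (prob (G n))%:E) @ \oo --> (prob U)%:E.
    rewrite -probE//; apply: cvg_trans cvgG; apply: near_eq_cvg.
    by apply: nearW => n /=; rewrite probE.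
  by move/fine_cvg.
have /cvgrPdist_lt/(_ e e0)[n _ /(_ n (leqnn n))/=] := cvgp.
have GU : G n `<=` U.
  by move=> x; rewrite /G -bigcup_mkord => -[i _ Fi]; exists i.
rewrite (probDI mU (mG n)) (setIidr GU) addrK => /ltr_normlW ?.
by exists n.+1.
Qed.

Lemma prob_bigcup_le (F : nat -> set X) (e : R) :
  (forall i, measurable (F i)) ->
  (forall n, \sum_(i < n) prob (F i) <= e) -> prob (\bigcup_i F i) <= e.
Proof.
move=> mF Fe; apply/ler_addgt0Pr => u u0.
have [n nu] := prob_bigcup_tail mF u0.
have mG : measurable (\big[setU/set0]_(i < n) F i) by exact: bigsetU_measurable.
have mU : measurable (\bigcup_i F i) by exact: bigcupT_measurable.
rewrite (probDI mU mG) addrC lerD//; last exact: ltW.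
apply: le_trans (Fe n); apply: le_trans (prob_bigsetU_le _ mF).
by apply: prob_le => //; exact: measurableI.
Qed.

Lemma prob_bigcup0 (F : nat -> set X) : (forall i, measurable (F i)) ->
  (forall i, prob (F i) = 0) -> prob (\bigcup_i F i) = 0.
Proof.
move=> mF F0; apply/eqP; rewrite eq_le prob_ge0 andbT.
by apply: prob_bigcup_le => // n; rewrite big1.
Qed.

End real_valued_probability.

(** * Iterates of invertible maps and rigid sets *)

Section mixing_of_invertible_maps.
Context d (X : measurableType d) (R : realType) (mu : probability X R).
Variables (T T' : X -> X).
Hypothesis TT' : inverse_measurable T T'.
Hypothesis T_mp : measure_preserving mu mu T.
Local Notation prob := (prob mu).

Let TK : cancel T T'. Proof. by case: TT'. Qed.
Let T'K : cancel T' T. Proof. by case: TT'. Qed.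
Let mT : measurable_fun setT T. Proof. by case: TT'. Qed.
Let mT' : measurable_fun setT T'. Proof. by case: TT'. Qed.

Lemma iterK_inverse n : cancel (iter n T) (iter n T').
Proof. by elim: n => // n ih x; rewrite iterSr /= TK ih. Qed.

Lemma iterK_direct n : cancel (iter n T') (iter n T).
Proof. by elim: n => // n ih x; rewrite iterSr /= T'K ih. Qed.

Lemma image_iterE n A : iter n T @` A = iter n T' @^-1` A.
Proof.
apply/seteqP; split=> [_ [x Ax <-]|x Ax] /=; first by rewrite iterK_inverse.
by exists (iter n T' x) => //; rewrite iterK_direct.
Qed.

Lemma measurable_preimage_iter (S : X -> X) n A : measurable_fun setT S ->
  measurable A -> measurable (iter n S @^-1` A).
Proof.
move=> mS; elim: n A => // n ih A mA.
have -> : iter n.+1 S @^-1` A = iter n S @^-1` (S @^-1` A) by [].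
by apply: ih; rewrite -[X in measurable X]setTI; exact: mS.
Qed.

Lemma measurable_iter n A : measurable A -> measurable (iter n T @^-1` A).
Proof. exact: measurable_preimage_iter. Qed.

Lemma measurable_iter_inverse n A : measurable A ->
  measurable (iter n T' @^-1` A).
Proof. exact: measurable_preimage_iter. Qed.

Lemma prob_iter n A : measurable A -> prob (iter n T @^-1` A) = prob A.
Proof.
elim: n A => // n ih A mA.
have -> : iter n.+1 T @^-1` A = iter n T @^-1` (T @^-1` A) by [].
rewrite ih; first by congr fine; exact: T_mp.
by rewrite -[X in measurable X]setTI; exact: mT.
Qed.

Lemma prob_iter_inverse n A : measurable A -> prob (iter n T' @^-1` A) = prob A.
Proof.
move=> mA; rewrite -(prob_iter n (measurable_iter_inverse n mA)); congr prob.
by apply/seteqP; split => x /=; rewrite iterK_inverse.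
Qed.

Lemma iter_inverse_comm n x : iter n T' (T x) = T (iter n T' x).
Proof. by elim: n => //= n ->; rewrite T'K TK. Qed.

(** Two sets of equal measure exceed one another by the same amount. *)
Lemma prob_iter_diffC n A : measurable A ->
  prob (iter n T' @^-1` A `\` A) = prob (A `\` iter n T' @^-1` A).
Proof.
move=> mA; have mB := measurable_iter_inverse n mA.
have := probDI mu mA mB; have := probDI mu mB mA.
rewrite prob_iter_inverse// (setIC A); lra.
Qed.

Section rigid_sets.
Variable n : nat -> nat.

(** The difference in the other direction has the same measure, by
    [prob_iter_diffC], so that bounding one of them is enough. *)
Definition rigid_along (E : set X) := measurable E /\
  forall e : R, 0 < e -> exists K, forall k, (K <= k)%N ->
    prob (iter (n k) T' @^-1` E `\` E) < e.

Lemma rigid_alongC E : rigid_along E -> rigid_along (~` E).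
Proof.
move=> [mE Erig]; split; first exact: measurableC.
move=> e e0; have [K EK] := Erig e e0; exists K => k Kk.
rewrite preimage_setC setDE setCK setIC -setDE -prob_iter_diffC//.
exact: EK.
Qed.

Lemma rigid_alongU E F : rigid_along E -> rigid_along F ->
  rigid_along (E `|` F).
Proof.
move=> [mE Erig] [mF Frig]; split; first exact: measurableU.
move=> e e0; have e20 : 0 < e / 2 by rewrite divr_gt0.
have [K EK] := Erig _ e20; have [L FL] := Frig _ e20.
exists (maxn K L) => k; rewrite geq_max => /andP[/EK Ek /FL Fk].
rewrite (splitr e); apply: le_lt_trans (ltrD Ek Fk).
have ? := measurable_iter_inverse (n k) mE.
have ? := measurable_iter_inverse (n k) mF.
apply: prob_subD; [|exact: measurableD..|].
  apply: measurableD; last exact: measurableU.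
  by rewrite preimage_setU; exact: measurableU.
by move=> x [[]/= ? /not_orP[? ?]]; [left|right].
Qed.

(** A countable union differs little from a finite partial union, uniformly in
    time since the iterates preserve the measure. *)
Lemma rigid_along_bigcup (F : nat -> set X) :
  (forall i, rigid_along (F i)) -> rigid_along (\bigcup_i F i).
Proof.
move=> Frig; have mF i : measurable (F i) by have [] := Frig i.
have mU : measurable (\bigcup_i F i) by exact: bigcupT_measurable.
split=> // e e0; have e20 : 0 < e / 2 by rewrite divr_gt0.
have [J FJ] := prob_bigcup_tail mu mF e20.
set G := \big[setU/set0]_(i < J) F i in FJ.
have [mG Grig] : rigid_along G.
  rewrite /G; elim: (J) => [|j ih]; last first.
    by rewrite big_ord_recr; exact: rigid_alongU.
  rewrite big_ord0; split => // u u0; exists 0%N => k _.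
  by rewrite preimage_set0 set0D prob_set0.
have [K GK] := Grig _ e20; exists K => k Kk.
rewrite (splitr e); apply: le_lt_trans (ltrD (GK k Kk) FJ).
have mUG := measurableD mU mG.
rewrite -(prob_iter_inverse (n k) mUG).
have ? := measurable_iter_inverse (n k) mU.
have ? := measurable_iter_inverse (n k) mG.
have ? := measurable_iter_inverse (n k) mUG.
apply: prob_subD => //; [exact: measurableD..|].
move=> x [/= Ux nUx]; have [Gx|nGx] := pselect (G (iter (n k) T' x)).
  left; split => //= Gx'; apply: nUx.
  by move: Gx'; rewrite /G -bigcup_mkord => -[i _ Fi]; exists i.
by right; split.
Qed.

Lemma sigma_algebra_rigid_along : sigma_algebra setT rigid_along.
Proof.
split; last exact: rigid_along_bigcup.
- split => // e e0; exists 0%N => k _.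
  by rewrite preimage_set0 set0D prob_set0.
- by move=> A /rigid_alongC; rewrite setTD.
Qed.

Lemma rigid_along_preimage E : rigid_along E -> rigid_along (T @^-1` E).
Proof.
move=> [mE Erig]; split; first exact: (measurable_iter 1).
move=> e /Erig[K EK]; exists K => k /EK; congr (_ < _).
set D := _ `\` E.
have mD : measurable D by apply: measurableD => //; exact: measurable_iter_inverse.
rewrite -(prob_iter 1 mD); congr prob.
by apply/seteqP; split=> x /=; rewrite /D /= iter_inverse_comm.
Qed.

Lemma rigid_along_preimage_inverse E : rigid_along E -> rigid_along (T' @^-1` E).
Proof.
move=> [mE Erig]; split; first exact: (measurable_iter_inverse 1).
move=> e /Erig[K EK]; exists K => k /EK; congr (_ < _).
set D := _ `\` E.
have mD : measurable D by apply: measurableD => //; exact: measurable_iter_inverse.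
rewrite -(prob_iter_inverse 1 mD); congr prob.
by apply/seteqP; split=> x /=; rewrite /D /= -iterS iterSr.
Qed.

End rigid_sets.

End mixing_of_invertible_maps.

(** * Mild mixing and escape *)

Section law.
Context d d' (X : measurableType d) (Y : measurableType d') (R : realType).
Variables (mu : probability X R) (f : X -> Y) (mf : measurable_fun setT f).

Let fM : isMeasurableFun _ _ X Y f.
Proof. by constructor. Qed.

Definition law : probability Y R :=
  distribution mu (HB.pack_for {mfun X >-> Y} f fM).

Lemma lawE A : law A = mu (f @^-1` A).
Proof. by []. Qed.

End law.

Lemma natSinv_lt (R : archiRealFieldType) (e : R) : 0 < e ->
  exists k, k.+1%:R^-1 < e.
Proof.
move=> e0; exists (Num.truncn e^-1); rewrite invf_plt ?posrE//.
exact: truncnS_gt.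
Qed.

(** For every element of the countable dense family and every precision 1/(k+1),
    one element of G at that distance is selected, if there is any. *)
Lemma separable_subfamily d (X : measurableType d) (R : realType)
    (mu : probability X R) (G : set (set X)) :
  separable_space mu -> G `<=` measurable ->
  exists D, [/\ countable D, D `<=` G & forall A, G A -> forall e : R, 0 < e ->
    exists2 B, D B & (mu (A `+` B) < e%:E)%E].
Proof.
move=> [D cD [mD denseD]] mG.
pose near (U : set X) k (E : set X) := G E /\ prob mu (U `+` E) < k.+1%:R^-1.
have /choice[pick pickP] : forall p : set X * nat, exists E,
    (exists E', near p.1 p.2 E') -> near p.1 p.2 E.
  move=> p; have [[E pE]|np] := pselect (exists E, near p.1 p.2 E).
    by exists E.
  by exists set0 => /np.
pose DN := (D `*` [set: nat]) `&` [set p | exists E, near p.1 p.2 E].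
exists (pick @` DN); split.
- apply: sub_countable (card_image_le _ _) _.
  apply: sub_countable (subset_card_le (@subIsetl _ _ _)) _.
  exact: countableX.
- by move=> _ [p [_ /pickP[GE _]] <-].
move=> B GB e e0; have [k ke] := natSinv_lt (divr_gt0 e0 (ltr0n _ 2)).
have k0 : (0 : R) < k.+1%:R^-1 by rewrite invr_gt0.
have mB := mG _ GB; have [U DU BU] := denseD B mB _ k0.
have mU := mD _ DU.
have mY (V W : set X) : measurable V -> measurable W -> measurable (V `+` W).
  by move=> mV mW; rewrite setY_def; apply: measurableU; exact: measurableD.
have ex : exists E, near U k E.
  by exists B; split=> //; rewrite -lte_fin -probE 1?setYC//; exact: mY.
have [/= GE UE] := pickP (U, k) ex; have mE := mG _ GE.
exists (pick (U, k)); first by exists (U, k).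
rewrite probE ?lte_fin; last exact: mY.
rewrite probE ?lte_fin in BU; last exact: mY.
rewrite (splitr e); apply: le_lt_trans (ltrD (lt_trans BU ke) (lt_trans UE ke)).
apply: prob_subD; [exact: mY..|].
by move=> x; rewrite !setY_def /=; have := EM (U x); tauto.
Qed.

(** The family of sets that are rigid along a sequence of times is an invariant
    sub-sigma-algebra, that is, a rigid factor; hence a set that returns to
    itself along such a sequence is trivial. *)
Lemma mild_mixing_escape d (X : measurableType d) (R : realType)
    (mu : probability X R) (T T' : X -> X) (A : set X) :
  separable_space mu -> inverse_measurable T T' -> measure_preserving mu mu T ->
  mildly_mixing mu T -> measurable A -> 0 < prob mu A -> prob mu A < 1 ->
  exists c : R, 0 < c /\ exists N, forall n, (N <= n)%N ->
    c <= prob mu (iter n T' @^-1` A `\` A).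
Proof.
move=> mu_sep TT' T_mp mild mA A0 A1; apply: contrapT => noc.
have returns k : exists n, (k <= n)%N /\
    prob mu (iter n T' @^-1` A `\` A) < k.+1%:R^-1.
  apply: contrapT => /forallNP nok; apply: noc; exists k.+1%:R^-1; split.
    by rewrite invr_gt0.
  exists k => n kn; rewrite leNgt; apply/negP => lt; exact: (nok n).
have [n n_prop] := choice returns.
pose rig := rigid_along mu T' n.
have srig : sigma_algebra setT rig := sigma_algebra_rigid_along TT' T_mp n.
pose Y := g_sigma_algebraType rig.
have mYE (E : set Y) : measurable E <-> rig E.
  by rewrite measurable_g_measurableTypeE.
have rigA : rig A.
  split=> // e e0; exists (Num.truncn e^-1) => k Kk.
  apply: lt_le_trans (n_prop k).2 _.
  rewrite invf_ple ?posrE// ltW// (lt_le_trans (truncnS_gt _))//.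
  by rewrite ler_nat ltnS.
have mid : measurable_fun setT (idfun : X -> Y).
  by move=> _ B /mYE[mB _]; rewrite setTI.
pose nu : probability Y R := law mu mid.
have nuE (E : set Y) : nu E = mu E by [].
have rig_cvg (E : set X) : rig E ->
    (fun k => mu ((iter (n k) T @` E) `+` E)) @ \oo --> 0%E.
  move=> [mE Erig].
  have mpre k : measurable (iter (n k) T' @^-1` E).
    exact: (measurable_iter_inverse TT').
  have -> : (fun k => mu ((iter (n k) T @` E) `+` E)) =
      (fun k => (2 * prob mu (iter (n k) T' @^-1` E `\` E))%:E).
    apply/funext => k; rewrite (image_iterE TT') setY_def.
    have mD1 : measurable (iter (n k) T' @^-1` E `\` E) by exact: measurableD.
    have mD2 : measurable (E `\` iter (n k) T' @^-1` E) by exact: measurableD.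
    rewrite probE; last exact: measurableU.
    rewrite probU//; last by apply/seteqP; split=> [x [[_ nE] [/nE]]|x].
    by rewrite -(prob_iter_diffC TT' T_mp)// mulrDl mul1r.
  apply: cvg_EFin; first exact: nearW.
  apply/cvgrPdist_lt => e e0.
  have [K EK] := Erig _ (divr_gt0 e0 (ltr0n _ 2)).
  exists K => //= k Kk; rewrite sub0r normrN ger0_norm.
    by rewrite mulrC -ltr_pdivlMr// EK.
  by rewrite mulr_ge0// prob_ge0.
have rigidnu : rigid nu (T : Y -> Y).
  exists n; last by move=> E /mYE; exact: rig_cvg.
  apply/cvgnyPge => N; exists N => //= k Nk.
  by apply: leq_trans Nk _; have [] := n_prop k.
have sepnu : separable_space nu.
  have [D [cD Drig denseD]] :=
    separable_subfamily mu_sep (fun E (rE : rig E) => rE.1).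
  exists D => //; split=> [E DE|E /mYE rE]; first exact/mYE/Drig.
  exact: denseD.
have mpnu : mp_transformation nu (T : Y -> Y).
  split; last by move=> E /mYE[mE _]; exact: T_mp.
  have [TK T'K _ _] := TT'.
  exists (T' : Y -> Y); split=> //.
    move=> _ B /mYE rB; rewrite setTI; apply/mYE.
    exact: rigid_along_preimage.
  move=> _ B /mYE rB; rewrite setTI; apply/mYE.
  exact: (rigid_along_preimage_inverse TT').
have facnu : is_factor mu T nu (T : Y -> Y).
  by exists idfun; split => //; exact: aeW.
have [nuA|nuA] := mild _ _ _ _ sepnu mpnu facnu rigidnu A ((mYE A).2 rigA).
  by move: A0; rewrite /prob -nuE nuA ltxx.
by move: A1; rewrite /prob -nuE nuA ltxx.
Qed.

(** * Towers and small lightly mixing pairs *)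

Section small_light_pairs.
Context d (X : measurableType d) (R : realType) (mu : probability X R).
Variables (T T' : X -> X).
Hypothesis TT' : inverse_measurable T T'.
Hypothesis T_mp : measure_preserving mu mu T.
Hypothesis escape : forall A, measurable A -> 0 < prob mu A -> prob mu A < 1 ->
  exists c : R, 0 < c /\ exists N, forall n, (N <= n)%N ->
    c <= prob mu (iter n T' @^-1` A `\` A).
Local Notation prob := (prob mu).

(** T' is the inverse of T, so that the preimage of A under its n-th iterate is
    the image of A under the n-th iterate of T. *)
Definition light_pair (A B : set X) := exists c : R, 0 < c /\
  exists N, forall n, (N <= n)%N -> c <= prob (iter n T' @^-1` A `&` B).

Let mpre n A : measurable A -> measurable (iter n T @^-1` A).
Proof. exact: (measurable_iter TT'). Qed.

Let mpre' n A : measurable A -> measurable (iter n T' @^-1` A).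
Proof. exact: (measurable_iter_inverse TT'). Qed.

Lemma iterB_inverse m n x : (m <= n)%N -> iter n T' (iter m T x) =
  iter (n - m) T' x.
Proof.
by move=> mn; rewrite -{1}(subnK mn) iterD (iterK_inverse TT').
Qed.

Lemma iterB_direct m n x : (n <= m)%N -> iter n T' (iter m T x) =
  iter (m - n) T x.
Proof.
by move=> mn; rewrite -{1}(subnKC mn) iterD (iterK_inverse TT').
Qed.

Lemma iter_comm m n x : iter n T' (iter m T x) = iter m T (iter n T' x).
Proof. by elim: m => //= m ih; rewrite (iter_inverse_comm TT') ih. Qed.

(** Otherwise the set would be invariant under all powers of the t-th iterate,
    hence would not escape from itself. *)
Lemma prob_diff_iter_gt0 B t : measurable B -> 0 < prob B -> prob B < 1 ->
  (0 < t)%N -> 0 < prob (B `\` iter t T' @^-1` B).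
Proof.
move=> mB B0 B1 t0; rewrite lt_neqAle prob_ge0 andbT eq_sym; apply/eqP.
rewrite -(prob_iter_diffC TT' T_mp)// => Bt.
have inv k : prob (iter (k * t) T' @^-1` B `\` B) = 0.
  elim: k => [|k ih]; first by rewrite mul0n setDv prob_set0.
  apply/eqP; rewrite eq_le prob_ge0 andbT -[leRHS]addr0.
  rewrite -[X in _ <= X + _]Bt -[X in _ <= _ + X]ih.
  have mD : measurable (iter t T' @^-1` B `\` B) by exact/measurableD/mB/mpre'.
  rewrite -(prob_iter_inverse TT' T_mp (k * t) mD).
  apply: prob_subD; [exact/measurableD/mB/mpre'|exact: mpre'|
    exact/measurableD/mB/mpre'|].
  move=> x [/=]; rewrite mulSn iterD => ? ?.
  by have [|] := pselect (B (iter (k * t) T' x)); [right|left].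
have [c [c0 [N /(_ (N * t)%N)]]] := escape mB B0 B1.
by rewrite leq_pmulr// inv leNgt c0 => /(_ isT).
Qed.

(** Removing from the base its image at time t makes it disjoint from that image
    and preserves the disjointness obtained for shorter times. *)
Lemma tower_base A h : measurable A -> 0 < prob A -> prob A < 1 ->
  exists B, [/\ measurable B, 0 < prob B, prob B < 1 &
    forall t, (0 < t < h)%N -> B `&` iter t T' @^-1` B = set0].
Proof.
move=> mA A0 A1; elim: h => [|h [B [mB B0 B1 Bh]]].
  by exists A; split => // t; rewrite andbF.
have [->|h0] := posnP h.
  by exists B; split => // t; rewrite ltnS; case: ltngtP.
have mB' : measurable (B `\` iter h T' @^-1` B) by exact/measurableD/mpre'.
exists (B `\` iter h T' @^-1` B); split => //.
- exact: prob_diff_iter_gt0.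
- by apply: le_lt_trans B1; apply: prob_le => //; exact: subDsetl.
move=> t /andP[t0]; rewrite ltnS leq_eqVlt => /orP[/eqP ->|th].
  by apply/seteqP; split=> // x [[_ /= nBx] [Bx _]].
rewrite -subset0 -(Bh t) ?t0// => x [[Bx _] [Btx _]]; by split.
Qed.

Section tower.
Variables (B : set X) (h : nat).
Hypotheses (mB : measurable B) (B0 : 0 < prob B) (B1 : prob B < 1).
Hypothesis Bh : forall t, (0 < t < h)%N -> B `&` iter t T' @^-1` B = set0.

(** The points whose last visit to the base was t steps ago. *)
Definition level t : set X :=
  iter t T' @^-1` B `\` \bigcup_(s in [set s | (s < t)%N]) iter s T' @^-1` B.

Lemma measurable_level t : measurable (level t).
Proof. by apply: measurableD; [|apply: bigcup_measurable => s _]; exact: mpre'. Qed.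

Lemma level_lt z s t : (s < t)%N -> level s z -> ~ level t z.
Proof. by move=> st [Bs _] [_]; apply; exists s. Qed.

Lemma level_inj z s t : level s z -> level t z -> s = t.
Proof.
move=> zs zt; case: (ltngtP s t) => // st.
  by case: (level_lt st zs zt).
by case: (level_lt st zt zs).
Qed.

(** The union of the iterates of the base is mapped into itself, and would
    escape from itself if it were not of full measure. *)
Lemma prob_bigcup_level : prob (~` \bigcup_t level t) = 0.
Proof.
set W := \bigcup_t level t.
have WE : W = \bigcup_t iter t T' @^-1` B.
  apply/seteqP; split=> [z [t _ [Bt _]]|z [t _ Bt]]; first by exists t.
  have ex : exists s, `[< B (iter s T' z) >] by exists t; exact/asboolP.
  have [s /asboolP Bs smin] := ex_minnP ex.
  exists s => //; split => // -[u /= us Bu].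
  by have := smin u; rewrite leqNgt us => /(_ (asboolT Bu)).
have mW : measurable W by apply: bigcupT_measurable; exact: measurable_level.
rewrite probC//; apply/eqP; rewrite subr_eq0 eq_sym; apply/contraT => W1.
have W0 : 0 < prob W.
  apply: (lt_le_trans B0); apply: prob_le => //.
  by rewrite WE => x Bx; exists 0%N.
have W1' : prob W < 1 by rewrite lt_neqAle W1 prob_le1.
have [c [c0 [N /(_ N (leqnn N))]]] := escape mW W0 W1'.
rewrite (_ : _ `\` _ = set0) ?prob_set0 ?leNgt ?c0//.
apply/seteqP; split=> // z []; rewrite /= WE => -[t _ Bt]; apply.
by exists (t + N)%N => //=; rewrite iterD.
Qed.

Lemma level_forward_base x t : B x -> (t < h)%N -> level t (iter t T x).
Proof.
move=> Bx th; split; first by rewrite /= (iterK_inverse TT').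
move=> [s /= st]; rewrite iterB_direct ?(ltnW st)// => Bs.
have : (B `&` iter (t - s) T' @^-1` B) (iter (t - s) T x).
  by split => //=; rewrite (iterK_inverse TT').
by rewrite Bh// subn_gt0 st/= (leq_ltn_trans (leq_subr _ _)).
Qed.

Lemma level_forward y l t : level l y ->
  (forall s, (0 < s <= t)%N -> ~ B (iter s T y)) -> level (l + t) (iter t T y).
Proof.
move=> [Bl nl] noret; split.
  by rewrite /= iterB_inverse ?leq_addl// addnK.
move=> [s /= slt]; have [ts|st] := leqP t s.
  rewrite iterB_inverse// => Bs; apply: nl; exists (s - t)%N => //=.
  by rewrite ltn_subLR// addnC.
rewrite iterB_direct ?(ltnW st)//; apply: noret.
by rewrite subn_gt0 st leq_subr.
Qed.

Lemma level_backward z t v : (v <= t)%N -> level t (iter v T z) ->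
  level (t - v) z.
Proof.
move=> vt [Bt nt]; split; first by rewrite /= -iterB_inverse.
move=> [s /= stv Bs]; apply: nt; exists (s + v)%N => /=.
  by rewrite addnC -ltn_subRL.
by rewrite iterB_inverse ?leq_addl// addnK.
Qed.

Definition levels (D : set nat) := \bigcup_(t in D) level t.

Lemma measurable_levels D : measurable (levels D).
Proof. by apply: bigcup_measurable => t _; exact: measurable_level. Qed.

Lemma levels_disjoint D E : D `&` E = set0 -> levels D `&` levels E = set0.
Proof.
move=> DE; apply/seteqP; split => // z [[s Ds zs] [t Et zt]].
have st := level_inj zs zt; have : (D `&` E) s by split => //; rewrite st.
by rewrite DE.
Qed.

Lemma prob_base_le : h%:R * prob B <= 1.
Proof.
pose F n := if (n < h)%N then iter n T' @^-1` B else set0.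
have mF n : measurable (F n) by rewrite /F; case: ifP => // _; exact: mpre'.
have tF : trivIset setT F.
  have F0 s t x : (s < t)%N -> F s x -> F t x -> False.
    rewrite /F => st; case: ifP => // sh; case: ifP => //= th Bs Bt.
    have : (B `&` iter (t - s) T' @^-1` B) (iter s T' x).
      by split => //=; rewrite -iterD subnK// ltnW.
    by rewrite Bh// subn_gt0 st/= (leq_ltn_trans (leq_subr _ _)).
  move=> s t _ _ [x [Fs Ft]]; case: (ltngtP s t) => // st.
    by case: (F0 _ _ _ st Fs Ft).
  by case: (F0 _ _ _ st Ft Fs).
have mU : measurable (\big[setU/set0]_(i < h) F i) by exact: bigsetU_measurable.
apply: le_trans (prob_le1 mu mU).
rewrite prob_bigsetU// (eq_bigr (fun=> prob B)); last first.
  by move=> i _; rewrite /F ltn_ord (prob_iter_inverse TT' T_mp).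
by rewrite sumr_const card_ord mulr_natl.
Qed.

Variable r : nat.
Hypotheses (r0 : (0 < r)%N) (rh : (2 * r <= h)%N).

(** Both sets of levels are arranged for [near_meets_comb]: 0 <= t < r and
    r < t < 2 r serve the two cases of its proof, and r itself belongs to the
    comb. *)
Definition near_levels : set nat := [set t | (t < 2 * r)%N /\ t != r].
Definition comb_levels : set nat := [set t | (0 < t)%N /\ (r %| t)%N].

Lemma near_comb_disjoint : near_levels `&` comb_levels = set0.
Proof.
apply/seteqP; split => // t [[t2r tr] [t0 /dvdnP[q tE]]].
move: t2r tr t0; rewrite tE ltn_pmul2r//.
by case: q {tE} => [|[|]]//=; rewrite mul1n eqxx.
Qed.

Lemma prob_near_levels : prob (levels near_levels) <= (2 * r)%:R * prob B.
Proof.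
have mb : measurable (\big[setU/set0]_(t < (2 * r)%N) level t).
  by apply: bigsetU_measurable => t _; exact: measurable_level.
apply: (@le_trans _ _ (prob (\big[setU/set0]_(t < (2 * r)%N) level t))).
  apply: prob_le => //; first exact: measurable_levels.
  by move=> z [t [t2r _] zt]; rewrite -bigcup_mkord; exists t.
apply: le_trans (prob_bigsetU_le _ _ measurable_level) _.
apply: (@le_trans _ _ (\sum_(t < (2 * r)%N) prob B)).
  apply: ler_sum => t _; rewrite -(prob_iter_inverse TT' T_mp t mB).
  apply: prob_le; [exact: measurable_level|exact: mpre'|exact: subDsetl].
by rewrite sumr_const card_ord mulr_natl.
Qed.

(** The r first backward translates of the comb are disjoint, since their levels
    have different residues modulo r. *)
Lemma prob_comb_levels : r%:R * prob (levels comb_levels) <= 1.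
Proof.
have mC := measurable_levels comb_levels.
pose F n := if (n < r)%N then iter n T @^-1` levels comb_levels else set0.
have mF n : measurable (F n) by rewrite /F; case: ifP => // _; exact: mpre.
have tF : trivIset setT F.
  move=> s t _ _ [x []]; rewrite /F; case: ifP => // sr; case: ifP => //= tr.
  move=> [a [a0 /dvdnP[p aE]] xa] [b [b0 /dvdnP[q bE]] xb].
  have sa : (s <= a)%N.
    rewrite (leq_trans (ltnW sr))// aE leq_pmull//; move: a0; rewrite aE.
    by case: (p).
  have tb : (t <= b)%N.
    rewrite (leq_trans (ltnW tr))// bE leq_pmull//; move: b0; rewrite bE.
    by case: (q).
  have ab := level_inj (level_backward sa xa) (level_backward tb xb).
  have : (p * r + t = q * r + s)%N.
    by rewrite -aE -bE -(subnK sa) -(subnK tb) ab addnAC.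
  by move/(congr1 (modn^~ r)); rewrite !modnMDl !modn_small.
have mU : measurable (\big[setU/set0]_(i < r) F i) by exact: bigsetU_measurable.
apply: le_trans (prob_le1 mu mU).
rewrite prob_bigsetU// (eq_bigr (fun=> prob (levels comb_levels))); last first.
  by move=> i _; rewrite /F ltn_ord (prob_iter TT' T_mp).
by rewrite sumr_const card_ord mulr_natl.
Qed.

(** Let x be in the base and y outside of it, at level l.  As long as neither
    returns, they climb simultaneously.  If y does not return before time r, it
    meets a multiple of r while x is still below r.  If it returns at time
    m < r, then x is at level m at that time, so r steps later y is at level r
    and x at level m + r. *)
Lemma near_meets_comb x y l : B x -> ~ B y -> level l y -> exists2 t,
  (t < 2 * r)%N &
  levels near_levels (iter t T x) /\ levels comb_levels (iter t T y).
Proof.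
move=> Bx nBy yl.
have l0 : (0 < l)%N by rewrite lt0n; apply/eqP => l0; case: yl; rewrite l0.
have [[m /andP[m0 mr] Bm]|noret] :=
    pselect (exists2 m, (0 < m < r)%N & B (iter m T y)).
  have mr2 : (m + r < 2 * r)%N by rewrite mul2n -addnn ltn_add2r.
  exists (m + r)%N => //; split; last first.
    exists r => //; rewrite addnC iterD; apply: level_forward_base => //.
    by apply: leq_trans rh; rewrite mul2n -addnn -[X in (X < _)%N]addn0 ltn_add2l.
  exists (m + r)%N; last by apply: level_forward_base => //; exact: leq_trans rh.
  by split => //; rewrite -[X in _ != X]add0n eqn_add2r -lt0n.
pose t := ((r - l %% r) %% r)%N.
have tr : (t < r)%N by rewrite ltn_pmod.
have t2r : (t < 2 * r)%N by rewrite (leq_trans tr)// leq_pmull.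
exists t => //; split.
  exists t; last by apply: level_forward_base => //; exact: leq_trans rh.
  by split => //; rewrite neq_ltn tr.
exists (l + t)%N.
  split; first by rewrite addn_gt0 l0.
  rewrite /dvdn /t modnDmr -modnDml subnKC ?modnn//.
  by rewrite ltnW// ltn_pmod.
apply: level_forward => // s /andP[s0 st] Bs; apply: noret; exists s => //.
by rewrite s0 (leq_ltn_trans st).
Qed.

(** At a large time n, the points outside of the base whose n-th preimage is in
    the base have a measure bounded below, and by [near_meets_comb] each of them
    comes within 2 r steps to a point counted in the light mixing of the pair. *)
Lemma near_comb_light : light_pair (levels near_levels) (levels comb_levels).
Proof.
have mN := measurable_levels near_levels.
have mC := measurable_levels comb_levels.
have [c [c0 [N cN]]] := escape mB B0 B1.
exists (c / (2 * r)%:R); split.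
  by rewrite divr_gt0// ltr0n muln_gt0.
exists N => n /cN cn; rewrite ler_pdivrMr ?ltr0n ?muln_gt0//.
set E := _ `&` levels comb_levels.
have mE : measurable E by apply: measurableI => //; exact: mpre'.
have mU : measurable (\bigcup_t level t).
  by apply: bigcupT_measurable; exact: measurable_level.
have mS : measurable (\big[setU/set0]_(t < (2 * r)%N) (iter t T @^-1` E)).
  by apply: bigsetU_measurable => t _; exact: mpre.
apply: (le_trans cn).
apply: (@le_trans _ _ (prob (\big[setU/set0]_(t < (2 * r)%N) (iter t T @^-1` E)))).
  rewrite -[leRHS]addr0 -prob_bigcup_level; apply: prob_subD => //.
  - exact/measurableD/mB/mpre'.
  - exact: measurableC.
  move=> z [Bnz nBz]; have [[l _ zl]|] := pselect ((\bigcup_t level t) z); last by right.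
  left; have [t t2r [nt ct]] := near_meets_comb Bnz nBz zl.
  rewrite -(bigcup_mkord _ (fun t => iter t T @^-1` E)); exists t => //.
  by split => //=; rewrite iter_comm.
apply: le_trans (prob_bigsetU_le _ _ (fun t => mpre t mE)) _.
rewrite (eq_bigr (fun=> prob E)); last first.
  by move=> t _; rewrite (prob_iter TT' T_mp).
by rewrite sumr_const card_ord mulr_natr.
Qed.

End tower.

Lemma small_light_pair A e : measurable A -> 0 < prob A -> prob A < 1 ->
  0 < e -> exists N C, [/\ measurable N, measurable C, N `&` C = set0,
    prob (N `|` C) <= e & light_pair N C].
Proof.
move=> mA A0 A1 e0.
have [k ke] := natSinv_lt (divr_gt0 e0 (ltr0n _ 2)).
pose r := k.+1.
have [j je] := natSinv_lt (divr_gt0 e0 (ltr0n _ 2)).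
pose h := (2 * r * j.+1)%N.
have [B [mB B0 B1 Bh]] := tower_base h mA A0 A1.
have rh : (2 * r <= h)%N by rewrite leq_pmulr.
exists (levels B (near_levels r)), (levels B (comb_levels r)); split.
- exact: measurable_levels.
- exact: measurable_levels.
- exact/levels_disjoint/near_comb_disjoint.
- apply: le_trans (probU_le _ _ _) _; [exact: measurable_levels..|].
  rewrite (splitr e) lerD//.
    apply: le_trans (prob_near_levels mB _) _; apply: le_trans (ltW je).
    rewrite -[leRHS]mul1r ler_pdivlMr ?ltr0n//.
    by rewrite mulrAC -natrM; exact: (prob_base_le mB Bh).
  apply: le_trans (ltW ke); rewrite -[leRHS]mul1r ler_pdivlMr ?ltr0n// mulrC.
  exact: prob_comb_levels.
- exact: (near_comb_light mB B0 B1 Bh).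
Qed.

End small_light_pairs.

(** * Disjoint lightly mixing pairs *)

(** The sizes of the pairs are chosen successively, each small compared with the
    light mixing constants of the previous ones, so that a pair remains lightly
    mixing when all the later ones are removed from it. *)
Lemma disjoint_light_pairs d (X : measurableType d) (R : realType)
    (mu : probability X R) (T T' : X -> X) :
  inverse_measurable T T' -> measure_preserving mu mu T ->
  (forall e : R, 0 < e -> exists N C, [/\ measurable N, measurable C,
     N `&` C = set0, prob mu (N `|` C) <= e & light_pair mu T' N C]) ->
  exists P : nat -> set X, [/\ forall k, measurable (P k), trivIset setT P &
    forall m, light_pair mu T' (P m.*2) (P m.*2.+1)].
Proof.
move=> TT' T_mp pairs.
have mpre' n A : measurable A -> measurable (iter n T' @^-1` A).
  exact: (measurable_iter_inverse TT').
have /choice[p pP] : forall e : R, exists p : set X * set X * R, 0 < e ->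
    [/\ [/\ measurable p.1.1, measurable p.1.2, p.1.1 `&` p.1.2 = set0 &
      prob mu (p.1.1 `|` p.1.2) <= e], 0 < p.2 & exists N, forall n, (N <= n)%N ->
      p.2 <= prob mu (iter n T' @^-1` p.1.1 `&` p.1.2)].
  move=> e; have [/pairs[N [C [mN mC NC NCe [c [c0 lNC]]]]]|e0] := ltP 0 e.
    by exists (N, C, c).
  by exists (set0, set0, 0).
pose delta m := iter m (fun e => Num.min e (p e).2 / 8) 1.
have deltaS m : delta m.+1 = Num.min (delta m) (p (delta m)).2 / 8 by [].
have delta0 m : 0 < delta m.
  elim: m => [|m ih]; first exact: ltr01.
  by rewrite deltaS divr_gt0// lt_min ih; have [] := pP _ ih.
pose N m := (p (delta m)).1.1; pose C m := (p (delta m)).1.2.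
pose c m := (p (delta m)).2; pose U m := N m `|` C m.
pose L m := \bigcup_i U (m.+1 + i)%N.
have mN m : measurable (N m) by have [[]] := pP _ (delta0 m).
have mC m : measurable (C m) by have [[]] := pP _ (delta0 m).
have mU m : measurable (U m) by exact: measurableU.
have mL m : measurable (L m) by exact: bigcupT_measurable.
have delta_half m : delta m.+1 <= delta m / 2.
  have : Num.min (delta m) (c m) <= delta m by rewrite ge_min lexx.
  have := delta0 m; rewrite deltaS -/(c m); lra.
have delta_c m : delta m.+1 <= c m / 8.
  by rewrite deltaS ler_pM2r ?invr_gt0// ge_min lexx orbT.
have sum_delta k n : \sum_(i < n) delta (k + i)%N <=
    2 * delta k - 2 * delta (k + n)%N.
  elim: n => [|n ih]; first by rewrite big_ord0 addn0 subrr.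
  rewrite big_ord_recr/= addnS; have := delta_half (k + n)%N.
  move: ih; set s := \sum_(i < n) _; lra.
have prob_L m : prob mu (L m) <= c m / 4.
  apply: prob_bigcup_le => // n.
  apply: (@le_trans _ _ (\sum_(i < n) delta (m.+1 + i)%N)).
    by apply: ler_sum => i _; have [[]] := pP _ (delta0 (m.+1 + i)%N).
  have := sum_delta m.+1 n; have := delta_c m; have := delta0 (m.+1 + n)%N.
  set s := \sum_(i < n) _; lra.
pose P k := (if odd k then C k./2 else N k./2) `\` L k./2.
have PU k : P k `<=` U k./2.
  by rewrite /P => x [+ _]; case: ifP => _; [right|left].
have Plt k l x : (k < l)%N -> P k x -> ~ P l x.
  move=> kl Pk Pl; have := half_leq (ltnW kl); rewrite leq_eqVlt => /orP[|kl2].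
    move=> /eqP kl2; move: Pk Pl; rewrite /P -kl2 => -[+ _] [+ _].
    have [[_ _ NC _] _ _] := pP _ (delta0 k./2).
    have : odd k != odd l.
      by apply: contraTneq kl => kl1; rewrite -(odd_double_half k) kl1 kl2
        odd_double_half ltnn.
    have F : ~ (N k./2 `&` C k./2) x by rewrite NC.
    case: (odd k); case: (odd l) => //= _ ? ?; exact: F.
  case: Pk => _; apply; exists (l./2 - k./2.+1)%N => //.
  by rewrite subnKC//; exact: PU.
exists P; split.
- by move=> k; apply: measurableD => //; case: ifP.
- move=> k l _ _ [x [Pk Pl]]; case: (ltngtP k l) => // kl.
    by case: (Plt _ _ _ kl Pk Pl).
  by case: (Plt _ _ _ kl Pl Pk).
move=> m; rewrite /P /= odd_double/= uphalf_double doubleK.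
have [_ c0 [M cM]] := pP _ (delta0 m).
exists (c m / 2); split; first by rewrite divr_gt0.
exists M => n /cM; rewrite -/(c m) -/(N m) -/(C m) => cn.
have mE : measurable (iter n T' @^-1` (N m `\` L m) `&` (C m `\` L m)).
  by apply: measurableI; [apply: mpre'|]; exact: measurableD.
have : prob mu (iter n T' @^-1` N m `&` C m) <=
    prob mu (iter n T' @^-1` (N m `\` L m) `&` (C m `\` L m)) +
    prob mu (iter n T' @^-1` L m `|` L m).
  apply: prob_subD => //; first by apply: measurableI => //; exact: mpre'.
    by apply: measurableU => //; exact: mpre'.
  move=> x [/= Nx Cx].
  have := EM (L m x); have := EM (L m (iter n T' x)); tauto.
have := probU_le mu (mpre' n _ (mL m)) (mL m).
rewrite (prob_iter_inverse TT' T_mp)//; have := prob_L m; lra.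
Qed.

(** * Borel embeddings into the real line *)

(** An isomorphism onto a measurable subset of the target. *)
Definition embedding d d' (X : measurableType d) (Y : measurableType d')
    (f : X -> Y) : Prop :=
  [/\ measurable_fun setT f, injective f &
    forall A, measurable A -> measurable (f @` A)].

Lemma embedding_comp d1 d2 d3 (X : measurableType d1) (Y : measurableType d2)
    (Z : measurableType d3) (f : X -> Y) (g : Y -> Z) :
  embedding f -> embedding g -> embedding (g \o f).
Proof.
move=> [mf fi fm] [mg gi gm]; split; first exact: measurableT_comp.
- exact: inj_comp.
- by move=> A mA; rewrite -image_comp; apply: gm; exact: fm.
Qed.

Lemma measurable_preimageT d d' (X : measurableType d) (Y : measurableType d')
    (f : X -> Y) A : measurable_fun setT f -> measurable A ->
  measurable (f @^-1` A).
Proof. by move=> mf mA; rewrite -[X in measurable X]setTI; exact: mf. Qed.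

Lemma measurable_fixpoints (R : realType) (f : R -> R) :
  measurable_fun setT f -> measurable [set t | f t = t].
Proof.
move=> mf; have -> : [set t | f t = t] = (f \- id) @^-1` [set 0].
  by apply/seteqP; split=> t /=; [move=> ->; exact: subrr|move/subr0_eq].
by apply: measurable_preimageT => //; exact: measurable_funB.
Qed.

(** The image of a measurable set is described by a left inverse, which is
    monotone, hence measurable. *)
Lemma incr_embedding (R : realType) (k : R -> R) :
  {homo k : x y / x < y} -> embedding k.
Proof.
move=> k_lt; have k_le : {homo k : x y / x <= y}.
  by move=> x y; rewrite le_eqVlt => /orP[/eqP -> //|/k_lt/ltW].
have mk : measurable_fun setT k by exact: nondecreasing_measurable.
have ki : injective k.
  by move=> x y kxy; case: (ltgtP x y) => // /k_lt; rewrite kxy ltxx.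
split=> // A mA.
(* a left inverse of k on [-n, n]; the point -n keeps the supremum meaningful
   for all y, so that r n is monotone on the whole line *)
pose S (n : nat) y := [set x | x = - n%:R \/ - n%:R <= x <= n%:R /\ k x <= y].
pose r n y := sup (S n y).
have supS n y : has_sup (S n y).
  split; first by exists (- n%:R); left.
  exists n%:R => x [->|[/andP[]]]//; have := ler0n R n; lra.
have mr n : measurable_fun setT (r n).
  apply: nondecreasing_measurable => // y z yz; apply: le_sup => //.
  - move=> x [->|[xn kxy]]; [exists (- n%:R)|exists x]; split=> //; first by left.
    by right; split => //; exact: le_trans yz.
  - by have [] := supS n y.
have rK n x : - n%:R <= x <= n%:R -> r n (k x) = x.
  move=> xn; apply/eqP; rewrite eq_le; apply/andP; split; last first.
    by apply: sup_upper_bound => //; right; split.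
  apply: ge_sup; first by have [] := supS n (k x).
  move=> z [->|[_ kzx]]; first by have [] := andP xn.
  by rewrite leNgt; apply/negP => /k_lt; rewrite ltNge kzx.
have -> : k @` A = \bigcup_n (r n @^-1` A `&` [set t | k (r n t) = t]).
  apply/seteqP; split=> [_ [x Ax <-]|t [n _ [Ar <-]]]; last by exists (r n t).
  exists (Num.bound `|x|) => //.
  have xn : - (Num.bound `|x|)%:R <= x <= (Num.bound `|x|)%:R.
    by rewrite -ler_norml ltW// archi_boundP.
  by rewrite /setI /= rK.
apply: bigcupT_measurable => n; apply: measurableI.
  exact: measurable_preimageT.
by apply: (measurable_fixpoints (f := k \o r n)); exact: measurableT_comp.
Qed.

(** Preimages and images under the glued map are countable unions over the
    pieces of the partition. *)
Lemma embedding_glue d (X : measurableType d) (R : realType) (f : X -> R)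
    (e : nat -> R -> R) (P : nat -> set X) :
  embedding f -> (forall k, embedding (e k)) ->
  (forall k l y z, e k y = e l z -> k = l) ->
  (forall k, measurable (P k)) -> trivIset setT P -> \bigcup_k P k = setT ->
  exists g : X -> R, embedding g /\ forall k x, P k x -> g x = e k (f x).
Proof.
move=> [mf fi fm] e_emb e_inj mP tP PT.
have /choice[idx Pidx] : forall x, exists k, P k x.
  move=> x; have [k _ Pk] : (\bigcup_k P k) x by rewrite PT.
  by exists k.
have idxE k x : P k x -> idx x = k.
  by move=> Pkx; apply: (tP _ _ I I); exists x.
pose g x := e (idx x) (f x).
have gE k x : P k x -> g x = e k (f x) by rewrite /g => /idxE ->.
exists g; split => //; split.
- move=> _ B mB; rewrite setTI.
  have -> : g @^-1` B = \bigcup_k (P k `&` f @^-1` (e k @^-1` B)).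
    apply/seteqP; split=> [x Bx|x [k _ [Pk]]] /=; last by rewrite -gE.
    by exists (idx x).
  apply: bigcupT_measurable => k; apply: measurableI => //.
  apply: measurable_preimageT => //; apply: measurable_preimageT => //.
  by have [] := e_emb k.
- move=> x y; rewrite /g => exy; have kl := e_inj _ _ _ _ exy.
  move: exy; rewrite -kl; have [_ ei _] := e_emb (idx x).
  by move/ei/fi.
move=> A mA; have -> : g @` A = \bigcup_k (e k @` (f @` (A `&` P k))).
  apply/seteqP; split=> [_ [x Ax <-]|_ [k _ [_ [x [Ax Px] <-] <-]]].
    by exists (idx x) => //; exists (f x) => //; exists x.
  by exists x => //; exact: gE.
apply: bigcupT_measurable => k; have [_ _ em] := e_emb k.
by apply: em; apply: fm; exact: measurableI.
Qed.

Section base_four_expansions.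
Variable R : realType.

Local Notation v := (4^-1 : R).

Definition rational (i : nat) : R := ratr (odflt 0 (unpickle i : option rat)).

Definition digits_upto (n : nat) (x : R) : R :=
  \sum_(i < n) v ^+ i.+1 * (rational i < x)%R%:R.

(** The number whose i-th digit in base four, 0 or 1, tells if the i-th rational
    is below x. *)
Definition cantor_embedding (x : R) : R := sup (range (digits_upto ^~ x)).

Let v0 n : 0 < v ^+ n. Proof. by rewrite exprn_gt0// invr_gt0. Qed.

Let vS n : v ^+ n.+1 = v ^+ n / 4. Proof. by rewrite exprSr. Qed.

Lemma digits_uptoS n x :
  digits_upto n.+1 x = digits_upto n x + v ^+ n.+1 * (rational n < x)%R%:R.
Proof. by rewrite /digits_upto big_ord_recr. Qed.

Lemma digits_upto_le n m x : digits_upto n x <= digits_upto (n + m) x.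
Proof.
elim: m => [|m ih]; first by rewrite addn0.
rewrite addnS digits_uptoS; apply: le_trans ih _; rewrite lerDl.
by rewrite mulr_ge0// ltW.
Qed.

Lemma digits_upto_ge n m x :
  digits_upto (n + m) x <= digits_upto n x + (v ^+ n - v ^+ (n + m)) / 3.
Proof.
elim: m => [|m ih]; first by rewrite addn0 subrr mul0r addr0.
rewrite addnS digits_uptoS vS; have := v0 (n + m)%N; move: ih.
case: (_ < x); rewrite ?mulr1 ?mulr0; lra.
Qed.

Lemma digits_upto_bound n m x :
  digits_upto m x <= digits_upto n x + v ^+ n / 3.
Proof.
have [nm|mn] := leqP n m.
  have := digits_upto_ge n (m - n) x; rewrite subnKC//; have := v0 m; lra.
have := digits_upto_le m (n - m) x; rewrite subnKC 1?ltnW//; have := v0 n; lra.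
Qed.

Lemma cantor_embedding_ge n x : digits_upto n x <= cantor_embedding x.
Proof.
apply: ub_le_sup; last by exists n.
exists (digits_upto 0 x + v ^+ 0 / 3) => _ [m _ <-].
exact: digits_upto_bound.
Qed.

Lemma cantor_embedding_le n x :
  cantor_embedding x <= digits_upto n x + v ^+ n / 3.
Proof.
apply: ge_sup; first by exists (digits_upto 0 x), 0%N.
by move=> _ [m _ <-]; exact: digits_upto_bound.
Qed.

Lemma cantor_embedding_itv x : 0 <= cantor_embedding x <= 1 / 3.
Proof.
have := cantor_embedding_le 0 x; have := cantor_embedding_ge 0 x.
by rewrite /digits_upto big_ord0 expr0 add0r => -> ->.
Qed.

Lemma digits_upto_nat n x : exists a : nat, digits_upto n x = a%:R * v ^+ n.
Proof.
elim: n => [|n [a aE]]; first by exists 0%N; rewrite /digits_upto big_ord0 mul0r.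
exists (4 * a + (rational n < x)%R)%N; rewrite digits_uptoS aE vS natrD natrM.
by set b := _%:R; set b' := _%:R; lra.
Qed.

(** A rational between x and y yields a digit that is 0 for x and 1 for y, while
    the earlier digits of x are at most those of y; the later digits of x weigh
    less than this difference. *)
Lemma cantor_embedding_incr : {homo cantor_embedding : x y / x < y}.
Proof.
move=> x y xy; have [q] := rat_in_itvoo xy; rewrite in_itv/= => /andP[xq qy].
set i := pickle q; have qE : rational i = ratr q by rewrite /rational pickleK.
have le_i : digits_upto i x <= digits_upto i y.
  apply: ler_sum => j _; apply: ler_wpM2l; first exact/ltW/v0.
  by case: ltP => [/lt_trans-> //|_]; rewrite ler0n.
have := cantor_embedding_le i.+1 x; have := cantor_embedding_ge i.+1 y.
rewrite !digits_uptoS qE qy ltNge (ltW xq)/= mulr1 mulr0.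
have := v0 i.+1; lra.
Qed.

Lemma embedding_cantor : embedding cantor_embedding.
Proof. exact/incr_embedding/cantor_embedding_incr. Qed.

Fixpoint prefixes n : seq R := if n is m.+1
  then prefixes m ++ [seq s + v ^+ m.+1 | s <- prefixes m] else [:: 0].

Lemma size_prefixes n : size (prefixes n) = (2 ^ n)%N.
Proof.
by elim: n => //= n ih; rewrite size_cat size_map ih addnn -mul2n expnS.
Qed.

Lemma digits_upto_prefixes n x : digits_upto n x \in prefixes n.
Proof.
elim: n => [|n ih]; first by rewrite /digits_upto big_ord0 inE.
rewrite digits_uptoS/= mem_cat; case: (_ < x); last by rewrite mulr0 addr0 ih.
by rewrite mulr1 (map_f (fun s => s + _)) ?orbT.
Qed.

Lemma lebesgue_measure_itv_seq (s : seq R) (e : R) : 0 <= e ->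
  (lebesgue_measure (\bigcup_(a in [set` s]) `[a, (a + e)%R]%classic)
    <= ((size s)%:R * e)%:E)%E.
Proof.
move=> e0; elim: s => [|a s ih].
  by rewrite set_nil bigcup_set0 measure0 mul0r.
have -> : \bigcup_(b in [set` a :: s]) `[b, (b + e)%R]%classic =
    `[a, (a + e)%R]%classic `|` \bigcup_(b in [set` s]) `[b, (b + e)%R]%classic.
  apply/seteqP; split=> [t [b /=]|t [ta|[b /= bs tb]]].
  - by rewrite inE => /predU1P[->|bs] tb; [left|right; exists b].
  - by exists a; rewrite //= mem_head.
  - by exists b; rewrite //= inE bs orbT.
rewrite /= -natr1 mulrDl mul1r (addrC (_ * e)) EFinD.
apply: le_trans (measureU2 _ _ _) _; first exact: measurable_itv.
  by apply: fin_bigcup_measurable => // b _; exact: measurable_itv.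
apply: leeD => //; rewrite [leLHS]lebesgue_measure_itv/= lte_fin.
by case: ifPn => //; rewrite -EFinB lee_fin addrAC subrr add0r.
Qed.

(** For each n the range is covered by 2^n intervals of length 4^-n. *)
Lemma cantor_embedding_null : lebesgue_measure (range cantor_embedding) = 0%E.
Proof.
have mrange : measurable (range cantor_embedding).
  by have [_ _] := embedding_cantor; apply.
apply/eqP; rewrite eq_le measure_ge0 andbT; apply/lee_addgt0Pr => e e0.
rewrite add0e; have [k ke] := natSinv_lt e0.
pose U n := \bigcup_(a in [set` prefixes n]) `[a, (a + v ^+ n)%R]%classic.
have sub : range cantor_embedding `<=` U k.
  move=> _ [x _ <-]; exists (digits_upto k x); first exact: digits_upto_prefixes.
  rewrite /= in_itv/= cantor_embedding_ge/=.
  have := cantor_embedding_le k x; have := v0 k; lra.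
apply: (@le_trans _ _ (lebesgue_measure (U k))).
  apply: le_measure => //; rewrite inE//.
  by apply: fin_bigcup_measurable => // b _; exact: measurable_itv.
apply: le_trans (lebesgue_measure_itv_seq _ (ltW (v0 k))) _.
rewrite lee_fin size_prefixes; apply: le_trans (ltW ke).
rewrite natrX -exprMn (_ : 2 * v = 2^-1); last by lra.
rewrite exprVn lef_pV2 ?posrE// -natrX ler_nat.
exact: ltn_expl.
Qed.

Definition cell (a : int) (j : nat) : set R :=
  `[a%:~R * v ^+ j, (a + 1)%:~R * v ^+ j]%classic.

Lemma open_contains_cell (U : set R) : open U -> U !=set0 ->
  exists a j, cell a j `<=` U.
Proof.
move=> oU [x Ux]; have /nbhs_ballP[e /= e0 xeU] := open_nbhs_nbhs (conj oU Ux).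
have [j je] := natSinv_lt e0.
have vj : v ^+ j.+1 < e.
  apply: lt_trans je; rewrite exprVn ltf_pV2 ?posrE// -natrX ltr_nat.
  exact: ltn_expl.
pose a := Num.floor (x * 4 ^+ j.+1).
have := v0 j.+1; set w := v ^+ j.+1 in vj *; have : 4 ^+ j.+1 * w = 1.
  by rewrite -exprMn divff ?expr1n// pnatr_eq0.
have := floor_le (x * 4 ^+ j.+1); have := floorD1_gt (x * 4 ^+ j.+1).
rewrite -/a; set F := 4 ^+ _ => xa ax Fw w0.
exists a, j.+1 => t; rewrite /cell /= in_itv/= -/w => /andP[at1 ta].
apply: xeU; rewrite /ball/= ltr_norml.
have : a%:~R * w <= x by have := ler_wpM2r (ltW w0) ax; rewrite -mulrA Fw mulr1.
have : x < (a + 1)%:~R * w.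
  by have := xa; rewrite -(ltr_pM2r w0) -mulrA Fw mulr1.
move: at1 ta; rewrite intrD mulrDl mul1r; lra.
Qed.

(** A number whose digits are, from some place on, a 3 followed by 0 and 1
    only. *)
Definition cell_embedding (a : int) (j n : nat) (y : R) : R :=
  a%:~R * v ^+ j + v ^+ n.+1 * (3 + cantor_embedding y).

Lemma cell_embedding_sub a j n y : (j <= n)%N -> cell a j (cell_embedding a j n y).
Proof.
move=> jn; have /andP[y0 y1] := cantor_embedding_itv y.
rewrite /cell /= in_itv/= /cell_embedding lerDl mulr_ge0/=; [|exact: ltW|lra].
rewrite intrD mulrDl lerD2l mul1r vS.
apply: (@le_trans _ _ (v ^+ n)); first by have := v0 n; nra.
by apply: ler_wiXn2l => //; lra.
Qed.

Lemma embedding_cell a j n : embedding (cell_embedding a j n).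
Proof.
apply: incr_embedding => x y /cantor_embedding_incr xy.
by rewrite /cell_embedding ltrD2l ltr_pM2l// ltrD2l.
Qed.

(** At the place m of the later 3, the other number has the digits 0 and 1 only:
    multiplied by 4 ^ m, the two numbers have fractional parts in [3/4, 5/6] and
    in [0, 1/3]. *)
Lemma cell_embedding_disjoint a j n b i m y z : (j <= n)%N -> (i <= m)%N ->
  (n < m)%N -> cell_embedding a j n y <> cell_embedding b i m z.
Proof.
move=> jn im nm; rewrite /cell_embedding => E.
pose k := (m - n.+1)%N; have [c cE] := digits_upto_nat k y.
have := cantor_embedding_ge k y; have := cantor_embedding_le k y.
rewrite cE => yle yge; have /andP[z0 z1] := cantor_embedding_itv z.
pose M : R := v ^+ m; pose w : R := v ^+ n.+1.
have M0 : 0 < M by exact: v0.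
have w0 : 0 < w by exact: v0.
have wM : w * v ^+ k = M by rewrite /w /M -exprD subnKC.
have pw p : (p <= m)%N -> v ^+ p = (4 ^+ (m - p))%:~R * M.
  move=> pm; rewrite /M -{2}(subnKC pm) exprD mulrCA rmorphXn/= -exprMn.
  by rewrite (_ : 4%:~R * v = 1) ?expr1n ?mulr1// mulfV// intr_eq0.
pose u : int := a * 4 ^+ (m - j) + 3 * 4 ^+ (m - n.+1) + c%:Z - b * 4 ^+ (m - i).
have uE : u%:~R * M = M / 4 * (3 + cantor_embedding z) -
    w * (cantor_embedding y - c%:R * v ^+ k).
  have wE := pw n.+1 nm; have := pw j (leq_trans jn (ltnW nm)).
  move: E; rewrite mulrBr [w * (c%:R * _)]mulrCA wM (vS m) -/w -/M (pw i im) => E jE.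
  rewrite /u rmorphB !rmorphD !rmorphM/= -pmulrn.
  move: E wE jE; rewrite -/w.
  set p : R := (4 ^+ (m - j))%:~R; set q : R := (4 ^+ (m - n.+1))%:~R.
  rewrite (_ : 3%:~R = 3 :> R)//.
  set s : R := (4 ^+ (m - i))%:~R => E wE jE; rewrite jE in E.
  lra.
have u0 : 0 < u%:~R * M.
  rewrite uE; have : w * (cantor_embedding y - c%:R * v ^+ k) <= w * (v ^+ k / 3).
    by rewrite ler_pM2l//; lra.
  rewrite mulrA wM; have : 0 <= M * cantor_embedding z by rewrite mulr_ge0// ltW.
  lra.
have u1 : u%:~R * M < M.
  rewrite uE; have : 0 <= w * (cantor_embedding y - c%:R * v ^+ k).
    by apply: mulr_ge0; [exact: ltW|rewrite subr_ge0].
  have : M * cantor_embedding z <= M * (1 / 3) by rewrite ler_pM2l.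
  lra.
have u1' : u%:~R < 1 :> R by rewrite -(ltr_pM2r M0) mul1r.
move: u0 u1'; rewrite pmulr_lgt0// ltr0z (ltr_int _ _ 1).
by case: u {uE u1} => // -[|[]].
Qed.

End base_four_expansions.

(** The images of the pieces may be prescribed up to an embedding because R
    contains countably many disjoint copies of itself, one in each cell. *)
Lemma embedding_into_cells d (X : measurableType d) (R : realType) (f : X -> R)
    (P : nat -> set X) (a : nat -> int) (j : nat -> nat) :
  embedding f -> (forall k, measurable (P k)) -> trivIset setT P ->
  exists g : X -> R, embedding g /\
    forall k x, P k x -> cell (a k) (j k) (g x).
Proof.
move=> f_emb mP tP.
pose Q k := if k is k'.+1 then P k' else ~` \bigcup_k P k.
pose b k := if k is k'.+1 then a k' else 0.
pose i k := if k is k'.+1 then j k' else 0%N.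
pose n k := (\sum_(l < k.+1) (i l).+1)%N.
have n_lt k l : (k < l)%N -> (n k < n l)%N.
  elim: l => // l ih; rewrite ltnS leq_eqVlt => /orP[/eqP ->|/ih kl].
    by rewrite [X in (_ < X)%N]/n big_ord_recr/= -/(n l) addnS ltnS leq_addr.
  by rewrite (ltn_trans kl)// [X in (_ < X)%N]/n big_ord_recr/= -/(n l) addnS
    ltnS leq_addr.
have in_ k : (i k <= n k)%N.
  by rewrite /n big_ord_recr/= addnS (leq_trans (leq_addl _ _) (leqnSn _)).
have [|||||g [g_emb gE]] := @embedding_glue _ X R f
    (fun k => cell_embedding (b k) (i k) (n k)) Q f_emb.
- by move=> k; exact: embedding_cell.
- move=> k l y z E; case: (ltngtP k l) => // /n_lt kl.
    by case: (cell_embedding_disjoint (in_ k) (in_ l) kl E).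
  by case: (cell_embedding_disjoint (in_ l) (in_ k) kl (esym E)).
- by case=> [|k] //=; apply: measurableC; exact: bigcupT_measurable.
- move=> [|k] [|l] _ _ [x []] //=; first by move=> nP Pl; case: nP; exists l.
    by move=> Pk; case; exists k.
  by move=> Pk Pl; congr _.+1; apply: tP => //; exists x.
- apply/seteqP; split => // x _.
  have [[k _ Pk]|nP] := pselect ((\bigcup_k P k) x); first by exists k.+1.
  by exists 0%N.
exists g; split => // k x Px.
by rewrite (gE k.+1 x Px); exact: (cell_embedding_sub (a k) _ (in_ k.+1)).
Qed.

(** * Distribution functions and quantiles of atomless laws *)

Lemma measurable_I01_val (R : realType) : measurable_fun setT (@I01_val R).
Proof. by move=> _ B mB; exists B. Qed.

Lemma lebesgue01_preimage (R : realType) (B : set R) :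
  @lebesgue01 R (@I01_val R @^-1` B) = lebesgue_measure (B `&` `[0, 1[).
Proof.
rewrite /lebesgue01; congr lebesgue_measure.
apply/seteqP; split => [_ [x Bx <-]|x [Bx x01]].
  by split => //; exact: (@set_valP _ _ x).
by exists (exist _ x (mem_set x01)).
Qed.

Section distribution_function.
Variables (R : realType) (nu : probability R R).
Hypothesis nu_atomless : forall t, prob nu [set t] = 0.

Lemma prob_nondecreasing_lim d (X : measurableType d) (mu : probability X R)
    (A : nat -> set X) c :
  (forall n, measurable (A n)) -> {homo A : m n / (m <= n)%N >-> m `<=` n} ->
  c < prob mu (\bigcup_n A n) -> exists n, c < prob mu (A n).
Proof.
move=> mA ndA; rewrite -subr_gt0 => c0.
have [n nc] := prob_bigcup_tail mu mA c0; exists n.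
have mU : measurable (\bigcup_n A n) by exact: bigcupT_measurable.
have mG : measurable (\big[setU/set0]_(i < n) A i) by exact: bigsetU_measurable.
have : prob mu (\bigcup_n A n) <= prob mu (\bigcup_n A n `\`
    \big[setU/set0]_(i < n) A i) + prob mu (A n).
  apply: prob_subD => //; first exact: measurableD.
  move=> x Ux; have [|nGx] := pselect ((\big[setU/set0]_(i < n) A i) x).
    by rewrite -bigcup_mkord => -[i /= ltin Aix]; right; exact: (ndA _ _ (ltnW ltin)).
  by left.
lra.
Qed.

Definition cumulative t : R := prob nu `]-oo, t].
(** The usual generalized inverse of the distribution function; it is an actual
    right inverse at the levels in ]0, 1[ since there are no atoms. *)
Definition quantile s : R := inf [set t | s <= cumulative t].
Local Notation F := cumulative.
Local Notation q := quantile.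

Lemma cumulative_ge0 t : 0 <= F t. Proof. exact: prob_ge0. Qed.

Lemma cumulative_le1 t : F t <= 1. Proof. exact: prob_le1. Qed.

Lemma cumulative_le : {homo F : s t / s <= t}.
Proof. by move=> s t st; apply: prob_le => //; exact: subitvPr. Qed.

Lemma measurable_cumulative : measurable_fun setT F.
Proof. exact: nondecreasing_measurable cumulative_le. Qed.

Lemma cumulativeE t : F t = prob nu `]-oo, t[.
Proof.
have UE : `]-oo, t]%classic = `]-oo, t[%classic `|` [set t] by rewrite setUitv1.
rewrite /F UE probU ?nu_atomless ?addr0//.
by apply/seteqP; split=> // x [/= xt xE]; move: xt; rewrite xE in_itv/= ltxx.
Qed.

Lemma cumulative_left_lim s t : s < F t -> exists2 u, u < t & s < F u.
Proof.
pose A (n : nat) : set R := [set` `]-oo, (t - n.+1%:R^-1 : R)]].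
have AE : `]-oo, t[%classic = \bigcup_n A n.
  apply/seteqP; split=> [u|u [n _]]; rewrite /A /= !in_itv/=.
    rewrite -subr_gt0 => /natSinv_lt[n nu']; exists n => //=.
    by rewrite in_itv/= lerBrDl -lerBrDr ltW.
  by move=> /le_lt_trans; apply; rewrite ltrBlDr ltrDl.
rewrite cumulativeE AE => /prob_nondecreasing_lim[n|m n mn|n sn].
- exact: measurable_itv.
- apply: subitvPr; rewrite bnd_simp lerB//.
  by rewrite lef_pV2 ?posrE// ler_nat ltnS.
- by exists (t - n.+1%:R^-1) => //; rewrite ltrBlDr ltrDl.
Qed.

Lemma cumulative_right_lim s t : F t < s -> exists2 u, t < u & F u < s.
Proof.
pose A (n : nat) : set R := [set` `](t + n.+1%:R^-1 : R), +oo[].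
have AE : `]t, +oo[%classic = \bigcup_n A n.
  apply/seteqP; split=> [u|u [n _]]; rewrite /A /= !in_itv/= !andbT.
    rewrite -subr_gt0 => /natSinv_lt[n nu']; exists n => //=.
    by rewrite in_itv/= andbT -ltrBrDl.
  by apply: le_lt_trans; rewrite lerDl.
have CE u : F u = 1 - prob nu `]u, +oo[ by rewrite -probC// setCitvr.
rewrite CE ltrBlDr addrC -ltrBlDr AE => /prob_nondecreasing_lim[n|m n mn|n sn].
- exact: measurable_itv.
- apply: subitvPl; rewrite bnd_simp lerD2l.
  by rewrite lef_pV2 ?posrE// ler_nat ltnS.
- by exists (t + n.+1%:R^-1); rewrite ?ltrDl// CE; move: sn; rewrite /A; lra.
Qed.

Lemma cumulative_gt s : s < 1 -> exists t, s < F t.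
Proof.
rewrite -(prob_setT nu) (_ : setT = \bigcup_n [set` `]-oo, (n%:R : R)]]).
  move=> /prob_nondecreasing_lim[//||n sn]; last by exists n%:R.
  by move=> m n mn; apply: subitvPr; rewrite bnd_simp ler_nat.
apply/seteqP; split => // t _; exists (Num.bound `|t|) => //=.
rewrite in_itv/= ltW// (le_lt_trans (ler_norm _))//.
exact: archi_boundP.
Qed.

Lemma cumulative_lt s : 0 < s -> exists t, F t < s.
Proof.
move=> s0; have CE u : F u = 1 - prob nu `]u, +oo[ by rewrite -probC// setCitvr.
have : 1 - s < 1 by lra.
rewrite -[X in _ < X](prob_setT nu) (_ : setT = \bigcup_n [set` `](- n%:R : R), +oo[]).
  move=> /prob_nondecreasing_lim[//||n sn]; last by exists (- n%:R); rewrite CE; lra.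
  by move=> m n mn; apply: subitvPl; rewrite bnd_simp lerN2 ler_nat.
apply/seteqP; split => // t _; exists (Num.bound `|t|) => //=.
rewrite in_itv/= andbT ltrNl (le_lt_trans (ler_norm _))// normrN.
exact: archi_boundP.
Qed.

Section level.
Variable s : R.
Hypotheses (s0 : 0 < s) (s1 : s < 1).

Lemma has_inf_quantile : has_inf [set t | s <= F t].
Proof.
split; first by have [t /ltW] := cumulative_gt s1; exists t.
have [t ts] := cumulative_lt s0; exists t => u /= su.
by rewrite leNgt; apply/negP => /ltW/cumulative_le; rewrite leNgt (lt_le_trans ts).
Qed.

Lemma cumulative_quantile : F (q s) = s.
Proof.
have [ne lb] := has_inf_quantile.
apply/eqP; rewrite eq_le !leNgt; apply/andP; split; apply/negP.
  move=> /cumulative_left_lim[u uq su]; move: uq; rewrite ltNge => /negP; apply.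
  by apply: inf_lbound => //=; exact: ltW.
move=> /cumulative_right_lim[u qu us]; have [t /= st tu] := inf_lt ne qu.
by move: us; rewrite ltNge (le_trans st)// cumulative_le// ltW.
Qed.

Lemma quantile_le t : (q s <= t) = (s <= F t).
Proof.
have [ne lb] := has_inf_quantile.
apply/idP/idP => [qt|st]; last exact: inf_lbound.
by rewrite -cumulative_quantile; exact: cumulative_le.
Qed.

Lemma prob_cumulative_lt : prob nu [set t | F t < s] = s.
Proof.
rewrite -[RHS]cumulative_quantile cumulativeE; congr prob.
by apply/seteqP; split=> t /=; rewrite in_itv/= !ltNge quantile_le.
Qed.

End level.

Lemma quantile_incr : {in `]0, 1[ &, {homo q : s t / s < t}}.
Proof.
move=> s t; rewrite !in_itv/= => /andP[s0 s1] /andP[t0 t1] st.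
rewrite ltNge; apply/negP; rewrite quantile_le// cumulative_quantile//.
by rewrite leNgt st.
Qed.

Lemma measurable_quantile : measurable_fun (`]0, 1[%classic : set R) q.
Proof.
move=> _; apply: (measurability (@RGenOInfty.G R)) => [|/= _ [_] [x] -> <-|].
- exact: RGenOInfty.measurableE.
- rewrite (_ : _ `&` _ = `]0, 1[ `&` `]F x, +oo[).
    by apply: measurableI; exact: measurable_itv.
  apply/seteqP; split=> s [/=]; rewrite !in_itv/= !andbT => /andP[s0 s1];
    by rewrite s0 s1 !ltNge quantile_le.
- exact: measurable_itv.
Qed.

Lemma prob_cumulative_lt1 : prob nu [set t | F t < 1] = 1.
Proof.
have mlt s : measurable [set t | F t < s].
  rewrite (_ : mkset _ = F @^-1` `]-oo, s[).
    exact: measurable_preimageT measurable_cumulative (measurable_itv _).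
  by apply/seteqP; split=> t /=; rewrite in_itv.
apply/eqP; rewrite eq_le prob_le1//= leNgt; apply/negP => lt1.
pose p := prob nu [set t | F t < 1]; have p0 : 0 <= p by exact: prob_ge0.
have : prob nu [set t | F t < (p + 1) / 2] <= p.
  by apply: prob_le => // t /= /lt_trans; apply; move: lt1; rewrite -/p; lra.
by move: lt1; rewrite -/p => ?; rewrite prob_cumulative_lt; lra.
Qed.

(** By uniqueness of measures it suffices to treat the rays, for which this is
    [prob_cumulative_lt]. *)
Lemma law_cumulative B : measurable B ->
  nu (F @^-1` B) = lebesgue_measure (B `&` `[0, 1[).
Proof.
move=> mB; pose g (k : nat) : set R := `]-oo, k%:R[%classic.
have mI : measurable (`[0, 1[%classic : set R) by exact: measurable_itv.
pose m1 : {measure set R -> \bar R} := law nu measurable_cumulative.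
pose m2 : {measure set R -> \bar R} := law (@lebesgue01 R) (@measurable_I01_val R).
have m2E A : m2 A = lebesgue_measure (A `&` `[0, 1[).
  exact: lebesgue01_preimage.
have m1E A : m1 A = nu (F @^-1` A) by [].
rewrite -m1E -m2E.
apply: (measure_unique (@RGenInftyO.G R) g _ _ _ _ m1 m2) => //.
- exact: RGenInftyO.measurableE.
- move=> _ _ [x ->] [y ->]; exists (Num.min x y); apply/seteqP.
  split=> t; rewrite /= !in_itv/= lt_min; first by move=> [-> ->].
  by move=> /andP.
- by move=> k; exists k%:R.
- apply/seteqP; split => // t _; exists (Num.bound `|t|) => //=.
  rewrite /g /= in_itv/= (le_lt_trans (ler_norm _))//.
  exact: archi_boundP.
- move=> _ [s ->]; rewrite m2E m1E.
  have -> : F @^-1` `]-oo, s[ = [set t | F t < s].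
    by apply/seteqP; split=> t /=; rewrite in_itv.
  have mlt : measurable [set t | F t < s].
    rewrite (_ : mkset _ = F @^-1` `]-oo, s[).
      exact: measurable_preimageT measurable_cumulative (measurable_itv _).
    by apply/seteqP; split=> t /=; rewrite in_itv.
  rewrite probE//.
  have [s0|s0] := leP s 0.
    rewrite (_ : [set t | _] = set0); last first.
      apply/seteqP; split=> // t /= Fs; have := cumulative_ge0 t.
      by rewrite leNgt (lt_le_trans Fs).
    rewrite prob_set0 (_ : _ `&` _ = set0) ?measure0//.
    apply/seteqP; split=> // t [/=]; rewrite !in_itv/= => ts /andP[t0 _].
    by have := lt_le_trans ts s0; rewrite ltNge t0.
  have [s1|s1] := ltP s 1.
    rewrite prob_cumulative_lt// (_ : _ `&` _ = `[0, s[%classic).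
      by rewrite lebesgue_measure_itv/= lte_fin s0 sube0.
    apply/seteqP; split=> t /=; rewrite !in_itv/=; first by move=> [-> /andP[->]].
    by move=> /andP[-> ts]; rewrite ts (lt_trans ts).
  have -> : prob nu [set t | F t < s] = 1.
    apply/eqP; rewrite eq_le prob_le1//= -[leLHS]prob_cumulative_lt1.
    apply: prob_le => //; last by move=> t /= /lt_le_trans; apply.
    rewrite (_ : mkset _ = F @^-1` `]-oo, 1[).
      exact: measurable_preimageT measurable_cumulative (measurable_itv _).
    by apply/seteqP; split=> t /=; rewrite in_itv.
  rewrite (_ : _ `&` _ = `[0, 1[%classic).
    by rewrite lebesgue_measure_itv/= lte_fin ltr01 sube0.
  apply/seteqP; split=> t /=; rewrite !in_itv/=; first by case.
  by move=> /andP[-> t1]; rewrite t1 (lt_le_trans t1).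
- move=> k; rewrite m1E; apply: le_lt_trans (ltry 1).
  apply: probability_le1; apply: measurable_preimageT measurable_cumulative _.
  exact: measurable_itv.
Qed.

Definition regular_points : set R := [set t | 0 < F t < 1 /\ q (F t) = t].

Lemma measurable_regular_points : measurable regular_points.
Proof.
pose D := F @^-1` `]0, 1[%classic.
have mD : measurable D.
  exact: measurable_preimageT measurable_cumulative (measurable_itv _).
have mf : measurable_fun D ((q \o F) \- id).
  apply: measurable_funB; last exact: measurable_id.
  apply: (measurable_comp _ _ measurable_quantile); first exact: measurable_itv.
    by move=> _ [t Dt <-].
  exact: measurable_funTS measurable_cumulative.
rewrite (_ : regular_points = D `&` ((q \o F) \- id) @^-1` [set 0]).
  exact: mf.
apply/seteqP; split=> t; rewrite /regular_points /D /= in_itv/=.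
  by move=> [-> ->]; rewrite subrr.
by move=> [-> /subr0_eq].
Qed.

Lemma prob_cumulative_eq c : prob nu (F @^-1` [set c]) = 0.
Proof.
rewrite /prob law_cumulative//; apply/eqP.
have -> : lebesgue_measure ([set c] `&` `[0, 1[%classic) = 0%E; last by [].
apply/eqP; rewrite eq_le measure_ge0 andbT -(lebesgue_measure_set1 c).
by apply: le_measure; rewrite ?inE//; exact: measurableI.
Qed.

(** A point where quantile and distribution function are not inverse to each
    other lies on a flat part, at one of countably many heights. *)
Lemma prob_regular_points : prob nu regular_points = 1.
Proof.
have mr := measurable_regular_points.
pose Z (n : nat) := F @^-1` [set if n is m.+2 then F (rational R m) else n%:R].
have mZ n : measurable (Z n).
  exact: measurable_preimageT measurable_cumulative _.
suff : prob nu (~` regular_points) = 0 by rewrite probC//; lra.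
apply: prob0S; [exact: measurableC|exact: bigcupT_measurable mZ| |]; last first.
  by apply: prob_bigcup0 => // n; exact: prob_cumulative_eq.
move=> t /not_andP nreg; apply: contrapT => nZ.
have F0 : F t != 0 by apply/eqP => Ft; apply: nZ; exists 0%N.
have F1 : F t != 1 by apply/eqP => Ft; apply: nZ; exists 1%N.
have Ft0 : 0 < F t by rewrite lt_neqAle eq_sym F0 cumulative_ge0.
have Ft1 : F t < 1 by rewrite lt_neqAle F1 cumulative_le1.
case: nreg => [|qF]; first by rewrite Ft0 Ft1.
have : q (F t) <= t by rewrite quantile_le.
rewrite le_eqVlt => /predU1P[//|/rat_in_itvoo[x]].
rewrite in_itv/= => /andP[qx /ltW xt]; apply: nZ; exists (pickle x).+2 => //.
have xE : rational R (pickle x) = ratr x by rewrite /rational pickleK.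
rewrite /Z xE /=; apply/eqP; rewrite eq_le.
by rewrite -quantile_le// (ltW qx) cumulative_le.
Qed.

End distribution_function.

(** * Partial embeddings and null sets *)

(** The first clause, for B the full set, makes D measurable. *)
Definition embedding_on d d' (X : measurableType d) (Y : measurableType d')
    (D : set X) (f : X -> Y) : Prop :=
  [/\ forall B, measurable B -> measurable (D `&` f @^-1` B),
    forall x y, D x -> D y -> f x = f y -> x = y &
    forall A, measurable A -> measurable (f @` (A `&` D))].

Section partial_embeddings.
Context d1 d2 (X : measurableType d1) (Y : measurableType d2).
Implicit Types (f : X -> Y).

Lemma embedding_onT f : embedding f <-> embedding_on setT f.
Proof.
split=> [[mf fi fm]|[mf fi fm]].
  split=> [B mB|x y _ _ /fi//|A mA]; last by rewrite setIT; exact: fm.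
  exact: mf.
split=> [_ B mB|x y|A /fm]; [exact: mf|exact: fi|by rewrite setIT].
Qed.

Lemma embedding_on_domain D f : embedding_on D f -> measurable D.
Proof. by move=> [/(_ _ measurableT)]; rewrite preimage_setT setIT. Qed.

Lemma embedding_onS D E f : measurable E -> E `<=` D -> embedding_on D f ->
  embedding_on E f.
Proof.
move=> mE ED [mf fi fm]; split=> [B /mf mB|x y /ED ? /ED ?|A mA].
- rewrite (_ : _ `&` _ = E `&` (D `&` f @^-1` B)); first exact: measurableI.
  by rewrite setIA (setIidl ED).
- exact: fi.
- rewrite (_ : _ `&` E = (A `&` E) `&` D); first exact/fm/measurableI.
  by rewrite -setIA (setIidl ED).
Qed.

Lemma embedding_on_image D E f : embedding_on D f -> measurable E ->
  E `<=` D -> measurable (f @` E).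
Proof. by move=> [_ _ fm] mE ED; rewrite -(setIidl ED); exact: fm. Qed.

Lemma embedding_on_inverse D f : embedding_on D f -> exists g : Y -> X,
  embedding_on (f @` D) g /\ forall x, D x -> g (f x) = x.
Proof.
move=> fD; have mD := embedding_on_domain fD; have [mf fi fm] := fD.
have /choice[g gP] : forall y, exists x, (f @` D) y -> D x /\ f x = y.
  move=> y; have [[x Dx <-]|nDy] := pselect ((f @` D) y); first by exists x.
  by exists point => /nDy.
have gK x : D x -> g (f x) = x.
  by move=> Dx; have [|Dg fg] := gP (f x); [exists x|exact: fi].
exists g; split => //; split.
- move=> A mA; rewrite (_ : _ `&` _ = f @` (A `&` D)); first exact: fm.
  apply/seteqP; split=> [_ [[x Dx <-]] /=|_ [x [Ax Dx] <-]].
    by rewrite gK// => Ax; exists x.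
  by split; [exists x|rewrite /= gK].
- by move=> y z /gP[_ gy] /gP[_ gz] gyz; rewrite -gy gyz gz.
- move=> B mB; rewrite (_ : _ @` _ = D `&` f @^-1` B); first exact: mf.
  apply/seteqP; split=> [_ [y [By Dy] <-]|x [Dx Bx]].
    by have [Dg fg] := gP _ Dy; split=> //=; rewrite fg.
  by exists (f x); [split=> //; exists x|exact: gK].
Qed.

Lemma embedding_patch D f g : embedding_on D f -> embedding g ->
  (forall x y, D x -> f x <> g y) ->
  embedding (fun x => if pselect (D x) then f x else g x).
Proof.
move=> fD [mg gi gm] dfg; have mD := embedding_on_domain fD.
have [mf fi fm] := fD; set h := fun x => _.
have hD x : D x -> h x = f x by rewrite /h; case: pselect.
have hN x : ~ D x -> h x = g x by rewrite /h; case: pselect.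
split.
- move=> _ B mB; rewrite setTI.
  rewrite (_ : h @^-1` B = (D `&` f @^-1` B) `|` (~` D `&` g @^-1` B)).
    apply: measurableU; first exact: mf.
    by apply: measurableI; [exact: measurableC|exact: measurable_preimageT].
  apply/seteqP; split=> x /=.
    have [Dx|nDx] := pselect (D x); first by rewrite hD// => ?; left.
    by rewrite hN// => ?; right.
  by move=> [[Dx Bx]|[nDx Bx]]; [rewrite hD|rewrite hN].
- move=> x y; have [Dx|nDx] := pselect (D x); have [Dy|nDy] := pselect (D y).
  + by rewrite !hD//; exact: fi.
  + by rewrite hD// hN// => /dfg; case.
  + by rewrite hN// hD// => /esym/dfg; case.
  + by rewrite !hN//; exact: gi.
- move=> A mA; rewrite (_ : h @` A = f @` (A `&` D) `|` g @` (A `\` D)).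
    by apply: measurableU; [exact: fm|apply: gm; exact: measurableD].
  apply/seteqP; split=> [_ [x Ax <-]|y [[x [Ax Dx] <-]|[x [Ax nDx] <-]]].
  + have [Dx|nDx] := pselect (D x); first by rewrite hD//; left; exists x.
    by rewrite hN//; right; exists x.
  + by exists x; rewrite // hD.
  + by exists x; rewrite // hN.
Qed.

(** In the proof of the Cantor-Bernstein theorem, the set on which psi agrees with
    u is a countable union of measurable sets. *)
Lemma measurable_cantor_bernstein (u : X -> Y) (v : Y -> X) :
  embedding u -> embedding v -> exists (psi : X -> Y) (phi : Y -> X),
    inverse_measurable psi phi /\ forall x, psi x = u x \/ x = v (psi x).
Proof.
move=> [mu ui um] [mv vi vm].
pose fix A n := if n is m.+1 then v @` (u @` A m) else ~` range v.
have mA n : measurable (A n).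
  by elim: n => [|n ih] /=; [exact/measurableC/vm|exact/vm/um].
pose U := \bigcup_n A n; have mU : measurable U by exact: bigcupT_measurable.
have vuU a : U a -> U (v (u a)).
  by move=> [n _ An]; exists n.+1 => //; exists (u a) => //; exists a.
have NU x : ~ U x -> exists y, v y = x.
  move=> nUx; apply: contrapT => nvx; apply: nUx; exists 0%N => //= -[y _ yx].
  by apply: nvx; exists y.
have vU y : U (v y) -> (u @` U) y.
  move=> [[|n] _]; first by case; exists y.
  by move=> [_ [a Aa <-] /vi <-]; exists a => //; exists n.
have /choice[psi psiP] : forall x, exists y,
    (U x -> y = u x) /\ (~ U x -> v y = x).
  move=> x; have [Ux|nUx] := pselect (U x); first by exists (u x).
  by have [y yx] := NU _ nUx; exists y.
have /choice[phi phiP] : forall y, exists x,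
    ((u @` U) y -> U x /\ u x = y) /\ (~ (u @` U) y -> x = v y).
  move=> y; have [[x Ux <-]|nUy] := pselect ((u @` U) y); last by exists (v y).
  by exists x; split => // -[]; exists x.
have psiU x : U x -> psi x = u x by have [] := psiP x.
have psiN x : ~ U x -> v (psi x) = x by have [] := psiP x.
have phiU y : (u @` U) y -> U (phi y) /\ u (phi y) = y by have [] := phiP y.
have phiN y : ~ (u @` U) y -> phi y = v y by have [] := phiP y.
exists psi, phi; split; last first.
  by move=> x; have [/psiU|/psiN] := pselect (U x); [left|right].
split.
- move=> x; have [Ux|nUx] := pselect (U x).
    by rewrite psiU//; have [|_ /ui] := phiU (u x) => //; exists x.
  rewrite phiN ?psiN// => -[a Ua ua]; apply: (nUx).
  have <- : v (u a) = x by rewrite ua psiN.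
  exact: vuU.
- move=> y; have [Uy|nUy] := pselect ((u @` U) y).
    by have [Up up] := phiU _ Uy; rewrite psiU.
  by rewrite phiN//; apply: vi; rewrite psiN// => /vU.
- move=> _ B mB; rewrite setTI.
  rewrite (_ : psi @^-1` B = (U `&` u @^-1` B) `|` (~` U `&` v @` B)).
    apply: measurableU; first by apply: measurableI => //; exact: measurable_preimageT.
    by apply: measurableI; [exact: measurableC|exact: vm].
  apply/seteqP; split=> x /=.
    have [Ux|nUx] := pselect (U x); first by rewrite psiU//; left.
    by move=> Bx; right; split=> //; exists (psi x) => //; exact: psiN.
  move=> [[Ux]|[nUx [y By yx]]]; first by rewrite psiU.
  by rewrite (_ : psi x = y)//; apply: vi; rewrite psiN.
- move=> _ B mB; rewrite setTI.
  rewrite (_ : phi @^-1` B = u @` (B `&` U) `|` (~` (u @` U) `&` v @^-1` B)).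
    apply: measurableU; first exact/um/measurableI.
    by apply: measurableI; [exact/measurableC/um|exact: measurable_preimageT].
  apply/seteqP; split=> y /=.
    have [Uy|nUy] := pselect ((u @` U) y).
      by move=> Bp; left; have [Up up] := phiU _ Uy; exists (phi y).
    by rewrite phiN//; right.
  move=> [[x [Bx Ux] <-]|[nUy]]; last by rewrite phiN.
  have [|_ up] := phiU (u x); first by exists x.
  by rewrite (ui _ _ up).
Qed.

End partial_embeddings.

Lemma embedding_on_comp d1 d2 d3 (X : measurableType d1) (Y : measurableType d2)
    (Z : measurableType d3) (D : set X) (E : set Y) (f : X -> Y) (g : Y -> Z) :
  embedding_on D f -> embedding_on E g -> f @` D `<=` E ->
  embedding_on D (g \o f).
Proof.
move=> fD gE DE; have mD := embedding_on_domain fD.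
have [mf fi fm] := fD; have [mg gi gm] := gE.
have DE' x : D x -> E (f x) by move=> Dx; apply: DE; exists x.
split.
- move=> B /mg/mf; congr measurable; apply/seteqP.
  by split=> x [Dx] /=; [case|split=> //; split=> //; exact: DE'].
- by move=> x y Dx Dy /gi fxy; apply: fi => //; apply: fxy; exact: DE'.
- move=> A /fm/gm; congr measurable; apply/seteqP.
  split=> [_ [_ [[x [Ax Dx] <-] _] <-]|_ [x [Ax Dx] <-]]; first by exists x.
  by exists (f x) => //; split; [exists x|exact: DE'].
Qed.

Definition uniform01 (R : realType) : probability R R :=
  law (@lebesgue01 R) (@measurable_I01_val R).

Lemma uniform01E (R : realType) (B : set R) :
  uniform01 R B = lebesgue_measure (B `&` `[0, 1[).
Proof. exact: lebesgue01_preimage. Qed.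

Lemma uniform01_atomless (R : realType) (t : R) : uniform01 R [set t] = 0%E.
Proof.
rewrite uniform01E; apply/eqP.
rewrite eq_le measure_ge0 andbT -(lebesgue_measure_set1 t).
by apply: le_measure; rewrite ?inE//; apply: measurableI => //; exact: measurable_itv.
Qed.

Lemma cantor_embedding_uniform01_null (R : realType) :
  uniform01 R (range (@cantor_embedding R)) = 0%E.
Proof.
have mC : measurable (range (@cantor_embedding R)).
  by have [_ _] := embedding_cantor R; apply.
rewrite uniform01E; apply/eqP.
rewrite eq_le measure_ge0 andbT -(cantor_embedding_null R).
by apply: le_measure; rewrite ?inE//; apply: measurableI => //; exact: measurable_itv.
Qed.

Lemma cantor_embedding_in01 (R : realType) (x : R) :
  0 < cantor_embedding x < 1.
Proof.
have /andP[c0 _] := cantor_embedding_itv (x - 1).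
have /andP[_ c1] := cantor_embedding_itv x.
have /cantor_embedding_incr : x - 1 < x by rewrite ltrBlDr ltrDl.
lra.
Qed.

(** Inner regularity gives a compact subset of positive measure.  The quantile
    function of Lebesgue measure on this compact set takes its values in it and
    does not create mass, so it may be composed with an embedding of null
    range. *)
Lemma null_embedding (R : realType) (D : set R) : measurable D ->
  (0 < uniform01 R D)%E -> exists g : R -> R,
    [/\ embedding g, range g `<=` D & uniform01 R (range g) = 0%E].
Proof.
move=> mD D0; have mI : measurable (`[0, 1[%classic : set R) by exact: measurable_itv.
pose D1 : set R := D `&` `[0, 1[; pose unif := uniform01 R.
have mD1 : measurable D1 by exact: measurableI.
have D1E : lebesgue_measure D1 = (prob unif D)%:E by rewrite -uniform01E -probE.
have p0 : 0 < prob unif D by rewrite -lte_fin -probE.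
have [K [cK KD KDp]] : exists K, [/\ compact K, K `<=` D1 &
    (lebesgue_measure (D1 `\` K) < (prob unif D)%:E)%E].
  apply: lebesgue_regularity_inner => //.
  by apply: le_lt_trans (ltry (prob unif D)); rewrite -D1E.
have mK : measurable K by exact: compact_measurable.
have k0 : 0 < prob unif K.
  have mDK : measurable (D `\` K) by exact: measurableD.
  have : prob unif (D `\` K) < prob unif D.
    rewrite -lte_fin -[in ltLHS]probE// uniform01E.
    apply: le_lt_trans KDp; apply: le_measure; rewrite ?inE.
    - exact: measurableI.
    - exact: measurableD.
    - by move=> x [[Dx nKx] x01]; split.
  have : prob unif D <= prob unif (D `\` K) + prob unif K.
    by apply: prob_subD => // x Dx; have [Kx|nKx] := pselect (K x); [right|left].
  lra.
pose nu : probability R R := mnormalize (mrestr unif mK) unif.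
have nuE U : measurable U -> prob nu U = prob unif (U `&` K) / prob unif K.
  move=> mU; have mUK : measurable (U `&` K) by exact: measurableI.
  have nuU : nu U = ((if (unif (setT `&` K) == 0) || (unif (setT `&` K) == +oo)
      then fun V => unif V
      else fun V => unif (V `&` K) * (fine (unif (setT `&` K)))^-1%:E) U)%E by [].
  rewrite [LHS]/prob nuU setTI; move: nuU => _; case: ifPn.
    by rewrite (probE unif mK) eqe gt_eqF.
  by rewrite (probE unif mUK).
have nu_atomless t : prob nu [set t] = 0.
  rewrite nuE// (@prob0S _ _ _ _ _ [set t]) ?mul0r//; first exact: measurableI.
  by rewrite /prob uniform01_atomless.
pose q := quantile nu; pose F := cumulative nu.
have qK s : 0 < s -> s < 1 -> K (q s).
  move=> s0 s1; apply: contrapT => nKq.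
  have oK : open (~` K) by apply: closed_openC; exact: compact_closed.
  have /nbhs_ballP[e /= e0 ball_nK] := open_nbhs_nbhs (conj oK nKq).
  pose u := q s - e / 2.
  have null : prob nu `]u, q s] = 0.
    rewrite nuE//; apply/eqP; rewrite mulf_eq0; apply/orP; left; apply/eqP.
    rewrite (_ : _ `&` _ = set0) ?prob_set0//.
    apply/seteqP; split=> // x [/=]; rewrite in_itv/= /u => /andP[ux xq].
    by apply: ball_nK; rewrite /ball/= ger0_norm; lra.
  have : F (q s) <= F u + prob nu `]u, q s].
    apply: prob_subD => // x /=; rewrite !in_itv/= => ->.
    by case: (leP x u); [left|right].
  rewrite null addr0 /F /q cumulative_quantile// -quantile_le// -/q /u.
  lra.
pose g := q \o @cantor_embedding R.
have gE : embedding g.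
  apply: incr_embedding => x y /cantor_embedding_incr xy.
  by apply: quantile_incr => //; rewrite in_itv/= cantor_embedding_in01.
exists g; split => //.
  by move=> _ [x _ <-]; have /andP[c0 c1] := cantor_embedding_in01 x;
    have [] := KD _ (qK _ c0 c1).
have mg : measurable (range g) by have [_ _] := gE; apply.
have mC : measurable (range (@cantor_embedding R)).
  by have [_ _] := embedding_cantor R; apply.
have mFC : measurable (F @^-1` range (@cantor_embedding R)).
  exact: measurable_preimageT (measurable_cumulative nu) mC.
rewrite probE//; congr _%:E.
apply: (prob0S mg (measurableI _ _ mFC mK)).
  move=> _ [x _ <-]; have /andP[c0 c1] := cantor_embedding_in01 x.
  by split; [exists x; rewrite ///F /= cumulative_quantile|exact: qK].
have : prob nu (F @^-1` range (@cantor_embedding R)) = 0.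
  rewrite /prob law_cumulative// -uniform01E.
  by rewrite cantor_embedding_uniform01_null.
rewrite nuE// => /eqP; rewrite mulf_eq0 invr_eq0 (gt_eqF k0) orbF => /eqP.
exact.
Qed.

(** * Isomorphism with the unit interval *)

Lemma measurable_image_I01 (R : realType) (A : set (I01 R)) :
  measurable A -> measurable (@I01_val R @` A).
Proof.
case=> B mB <-; rewrite setTI.
have -> : @I01_val R @` (@I01_val R @^-1` B) = [set` `[0 : R, 1[] `&` B.
  apply/seteqP; split => [_ [x Bx <-]|x [x01 Bx]].
    by split => //; exact: (@set_valP _ _ x).
  by exists (exist _ x (mem_set x01)).
exact: measurableI.
Qed.

Lemma embedding_I01_val (R : realType) : embedding (@I01_val R).
Proof.
split; [exact: measurable_I01_val|exact: val_inj|exact: measurable_image_I01].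
Qed.

Lemma I01_val_in (R : realType) (y : I01 R) : 0 <= I01_val y < 1.
Proof. by have := @set_valP _ _ y; rewrite /= in_itv. Qed.

Lemma embedding_on_toI01 (R : realType) : exists toI01 : R -> I01 R,
  embedding_on (`[0, 1[%classic : set R) toI01 /\
  forall t, 0 <= t < 1 -> I01_val (toI01 t) = t.
Proof.
have [g [gE gK]] := embedding_on_inverse ((embedding_onT _).1 (embedding_I01_val R)).
have imE : range (@I01_val R) = `[0, 1[%classic.
  apply/seteqP; split=> [_ [y _ <-]|x x01]; first by rewrite /= in_itv/= I01_val_in.
  by exists (exist _ x (mem_set x01)).
exists g; rewrite -imE; split => // t t01.
have [y _ <-] : (range (@I01_val R)) t by rewrite imE /= in_itv.
by rewrite gK.
Qed.

(** The composite of the embedding with the distribution function of its law is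
    an isomorphism up to null sets.  To correct it, both spaces are embedded
    into each other, by this map and its inverse outside of null sets, and on
    these null sets by embeddings whose range is null; then the Cantor-Bernstein
    construction applies. *)
Theorem atomless_isomorphism d (X : measurableType d) (R : realType)
    (mu : probability X R) (f : X -> R) (f_emb : embedding f)
    (mf : measurable_fun setT f) :
  (forall t, prob mu (f @^-1` [set t]) = 0) ->
  exists (psi : X -> I01 R) (phi : I01 R -> X),
    [/\ inverse_measurable psi phi, measure_preserving mu (@lebesgue01 R) psi &
    exists2 N, measurable N /\ prob mu N = 0 & forall x, ~ N x ->
      I01_val (psi x) = cumulative (law mu mf) (f x)].
Proof.
move=> atomless; have [_ fi fm] := f_emb.
pose nu := law mu mf; pose F := cumulative nu; pose q := quantile nu.
have nu0 t : prob nu [set t] = 0 by exact: atomless.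
pose U x := F (f x); have mU : measurable_fun setT U.
  exact: measurableT_comp (measurable_cumulative nu) mf.
have U_law B : measurable B -> prob mu (U @^-1` B) = prob (uniform01 R) B.
  by move=> mB; rewrite /prob uniform01E -(law_cumulative nu0).
pose X1 := f @^-1` regular_points nu.
have mX1 : measurable X1.
  exact: measurable_preimageT mf (measurable_regular_points nu0).
have X1_full : prob mu X1 = 1 by exact: (prob_regular_points nu0).
have UX1 x : X1 x -> 0 < U x < 1 by case.
have qU x : X1 x -> q (U x) = f x by case.
have U_emb : embedding_on X1 U.
  split.
  - by move=> B mB; apply: measurableI => //; exact: measurable_preimageT.
  - by move=> x y /qU qx /qU qy Uxy; apply: fi; rewrite -qx -qy Uxy.
  - move=> A mA; have -> : U @` (A `&` X1) = `]0, 1[ `&` q @^-1` (f @` (A `&` X1)).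
      apply/seteqP; split=> [_ [x [Ax Xx] <-]|s [/=]].
        by split; rewrite /= ?in_itv/= ?UX1// qU//; exists x.
      rewrite in_itv/= => /andP[s0 s1] [x [Ax Xx] fx]; exists x => //.
      by rewrite /U fx /F cumulative_quantile.
    apply: (measurable_quantile nu0); first exact: measurable_itv.
    by apply: fm; apply: measurableI.
have [toI01 [to_emb toK]] := embedding_on_toI01 R.
have [Uinv [Uinv_emb UinvK]] := embedding_on_inverse U_emb.
have mUX1 : measurable (U @` X1) by exact: embedding_on_image U_emb mX1 _.
(* U must avoid the null ranges of the two auxiliary embeddings *)
pose C := range (@cantor_embedding R).
have mC : measurable C by have [_ _] := embedding_cantor R; apply.
have UC0 : prob mu (U @^-1` C) = 0.
  by rewrite U_law// /prob cantor_embedding_uniform01_null.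
have [|g [g_emb gX1 g0]] := null_embedding mUX1.
  rewrite probE// lte_fin -U_law//; apply: (@lt_le_trans _ _ 1) => //.
  rewrite -X1_full; apply: prob_le => //; first exact: measurable_preimageT.
  by move=> x Xx; exists x.
have mg : measurable (range g) by have [_ _] := g_emb; apply.
have Ug0 : prob mu (U @^-1` range g) = 0 by rewrite U_law// /prob g0.
pose X2 := X1 `\` U @^-1` C; pose X3 := X1 `\` U @^-1` range g.
have mX2 : measurable X2 by apply: measurableD => //; exact: measurable_preimageT.
have mX3 : measurable X3 by apply: measurableD => //; exact: measurable_preimageT.
have in01 t : 0 < t < 1 -> (`[0, 1[%classic : set R) t.
  by rewrite /= in_itv/= => /andP[/ltW -> ->].
have to_inj s t : 0 < s < 1 -> 0 < t < 1 -> toI01 s = toI01 t -> s = t.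
  by move=> s01 t01; have [_ + _] := to_emb; apply; exact: in01.
have toU_emb : embedding_on X2 (toI01 \o U).
  apply: embedding_on_comp to_emb _.
    by apply: (embedding_onS mX2 _ U_emb) => x [].
  by move=> _ [x [/UX1/in01 + _] <-].
have toC_emb : embedding (toI01 \o @cantor_embedding R \o f).
  apply/embedding_onT; apply: embedding_on_comp to_emb _.
    by apply/embedding_onT; exact: (embedding_comp f_emb (embedding_cantor R)).
  by move=> _ [x _ <-]; exact/in01/cantor_embedding_in01.
have u_emb := embedding_patch toU_emb toC_emb.
set u := fun x => if pselect (X2 x) then _ else _ in u_emb.
have {}u_emb : embedding u.
  apply: u_emb => x y [Xx nCx] /= /(to_inj _ _ (UX1 _ Xx) (cantor_embedding_in01 _)).
  by move=> Uxy; apply: nCx; rewrite /= Uxy; exists (f y).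
pose Y3 := @I01_val R @^-1` (U @` X3).
have mY3 : measurable Y3.
  apply: measurable_preimageT; first exact: measurable_I01_val.
  by apply: embedding_on_image U_emb mX3 _ => x [].
have val_emb : embedding_on Y3 (Uinv \o @I01_val R).
  apply: embedding_on_comp Uinv_emb _.
    by apply: embedding_onS mY3 _ ((embedding_onT _).1 (embedding_I01_val R)).
  by move=> _ [y [x [Xx _] Ux] <-]; exists x.
have iota_emb : embedding (Uinv \o (g \o @I01_val R)).
  apply/embedding_onT; apply: embedding_on_comp Uinv_emb _.
    by apply/embedding_onT; exact: embedding_comp (embedding_I01_val R) g_emb.
  by move=> _ [y _ <-]; apply: gX1; exists (I01_val y).
have Uinv_g y : exists2 x, Uinv (g y) = x & U x = g y.
  have [x Xx Ux] : (U @` X1) (g y) by apply: gX1; exists y.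
  by exists x; rewrite // -Ux UinvK.
have v_emb := embedding_patch val_emb iota_emb.
set v := fun y => if pselect (Y3 y) then _ else _ in v_emb.
have {}v_emb : embedding v.
  apply: v_emb => y z [x [Xx ngx] Ux] /=.
  rewrite -Ux UinvK//; have [x' -> Ux'] := Uinv_g (I01_val z) => xx'.
  by apply: ngx; rewrite /= xx' Ux'; exists (I01_val z).
have [psi [phi [psi_inv psi_uv]]] := measurable_cantor_bernstein u_emb v_emb.
have psiE x : X2 x -> X3 x -> I01_val (psi x) = U x.
  move=> X2x X3x; have [Xx _] := X2x.
  have [->|] := psi_uv x.
    rewrite /u; case: pselect => //= _; apply: toK.
    by have /andP[/ltW -> ->] := UX1 _ Xx.
  rewrite /v; case: pselect => /= [[x' X3x' Ux']|nY].
    by rewrite -Ux' UinvK; [move=> ->|case: X3x'].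
  have [x' -> Ux'] := Uinv_g (I01_val (psi x)) => xx'.
  by case: X3x => _; case; rewrite /= xx' Ux'; exists (I01_val (psi x)).
pose N := ~` X1 `|` (U @^-1` C `|` U @^-1` range g).
have mUC : measurable (U @^-1` C) by exact: measurable_preimageT.
have mUg : measurable (U @^-1` range g) by exact: measurable_preimageT.
have mN : measurable N by apply: measurableU; [exact: measurableC|exact: measurableU].
have N0 : prob mu N = 0.
  apply/eqP; rewrite eq_le prob_ge0 andbT.
  apply: le_trans (probU_le _ _ _) _; [exact: measurableC|exact: measurableU|].
  have := probU_le mu mUC mUg; rewrite UC0 Ug0 probC// X1_full; lra.
have psiN x : ~ N x -> I01_val (psi x) = U x.
  move=> /not_orP[/contrapT Xx /not_orP[nC ng]].
  by apply: psiE; split.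
exists psi, phi; split => //; last by exists N.
have [_ _ mpsi _] := psi_inv.
move=> _ [B mB <-]; rewrite setTI.
have mpB : measurable (psi @^-1` (@I01_val R @^-1` B)).
  by apply: measurable_preimageT => //; exact: measurable_preimageT (@measurable_I01_val R) mB.
have mUB : measurable (U @^-1` B) by exact: measurable_preimageT.
rewrite (probE mu mpB) -[RHS](lawE _ (@measurable_I01_val R)) -/(uniform01 R).
rewrite [RHS](probE (uniform01 R) mB) -U_law//; congr _%:E.
apply/eqP; rewrite eq_le; apply/andP; split.
  rewrite -[leRHS]addr0 -N0; apply: prob_subD => // x /= Bx.
  by have [Nx|/psiN E] := pselect (N x); [right|left; rewrite /= -E].
rewrite -[leRHS]addr0 -N0; apply: prob_subD => // x /= Bx.
by have [Nx|/psiN E] := pselect (N x); [right|left; rewrite /= E].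
Qed.

(** * Finite unions of intervals *)

(** The sets that are approximable by elements of an algebra form a
    sigma-algebra. *)
Lemma sigma_approximable d (X : measurableType d) (R : realType)
    (mu : probability X R) (C : set (set X)) :
  C `<=` measurable -> C set0 -> setC_closed C -> setU_closed C ->
  <<s C >> `<=` [set E | measurable E /\ forall e : R, 0 < e ->
    exists2 B, C B & prob mu (E `+` B) < e].
Proof.
move=> Cm C0 CC CU; pose G E := measurable E /\ forall e : R, 0 < e ->
  exists2 B, C B & prob mu (E `+` B) < e.
have mY (V W : set X) : measurable V -> measurable W -> measurable (V `+` W).
  by move=> mV mW; rewrite setY_def; apply: measurableU; exact: measurableD.
have G0 : G set0.
  by split => // e e0; exists set0; rewrite ?setYK ?prob_set0.
have GU E F : G E -> G F -> G (E `|` F).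
  move=> [mE Ea] [mF Fa]; split; first exact: measurableU.
  move=> e e0; have e20 : 0 < e / 2 by rewrite divr_gt0.
  have [B CB EB] := Ea _ e20; have [D CD FD] := Fa _ e20.
  have mB := Cm _ CB; have mD := Cm _ CD.
  exists (B `|` D); first exact: CU.
  rewrite (splitr e); apply: le_lt_trans (ltrD EB FD).
  apply: prob_subD; [|exact: mY..|]; first by apply: mY; exact: measurableU.
  by move=> x; rewrite !setY_def /=; tauto.
apply: smallest_sub => [|E CE]; last first.
  split; first exact: Cm.
  by move=> e e0; exists E; rewrite // setYK prob_set0.
split => //.
- move=> E [mE Ea]; rewrite setTD; split; first exact: measurableC.
  move=> e /Ea[B CB EB]; exists (~` B); first exact: CC.
  rewrite (_ : _ `+` _ = E `+` B)//; apply/seteqP.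
  by split=> x; rewrite !setY_def /=; have := EM (E x); have := EM (B x); tauto.
move=> F FG; have mF i : measurable (F i) by have [] := FG i.
have mU : measurable (\bigcup_i F i) by exact: bigcupT_measurable.
split => // e e0; have e20 : 0 < e / 2 by rewrite divr_gt0.
have [n Un] := prob_bigcup_tail mu mF e20.
set S := \big[setU/set0]_(i < n) F i in Un.
have [mS Sa] : G S.
  rewrite /S; elim: (n) => [|k ih]; first by rewrite big_ord0.
  by rewrite big_ord_recr; apply: GU => //; exact: FG.
have SU : S `<=` \bigcup_i F i.
  by move=> x; rewrite /S -bigcup_mkord => -[i _ Fi]; exists i.
have [B CB SB] := Sa _ e20; have mB := Cm _ CB.
exists B => //; rewrite (splitr e); apply: le_lt_trans (ltrD Un SB).
apply: prob_subD; [exact: mY|exact: measurableD|exact: mY|].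
move=> x; rewrite !setY_def /=; have := EM (S x); have := @SU x; tauto.
Qed.

Section step_sets.
Variable R : realType.

(** The finite unions of intervals with endpoints in s, described by the fact that
    membership of a point depends only on its position with respect to s: with
    this description a union is handled by concatenating the sequences of
    endpoints. *)
Definition step_set (A : set (I01 R)) := measurable A /\ exists s : seq R,
  forall x y, (forall t, t \in s ->
    ((t < I01_val x) = (t < I01_val y)) * ((I01_val x < t) = (I01_val y < t))) ->
  A x -> A y.

Definition fat (A : set (I01 R)) := exists a b : R,
  [/\ 0 <= a, a < b, b <= 1 & @I01_val R @^-1` `]a, b[%classic `<=` A].

Lemma step_set0 : step_set set0.
Proof. by split => //; exists [::]. Qed.

Lemma step_setC A : step_set A -> step_set (~` A).
Proof.
move=> [mA [s sA]]; split; first exact: measurableC.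
exists s => x y xy nAx Ay; apply: nAx; apply: sA Ay => t /xy[-> ->].
by [].
Qed.

Lemma step_setU A B : step_set A -> step_set B -> step_set (A `|` B).
Proof.
move=> [mA [s sA]] [mB [r rB]]; split; first exact: measurableU.
exists (s ++ r) => x y xy [Ax|Bx]; [left; apply: sA Ax|right; apply: rB Bx].
  by move=> t ts; apply: xy; rewrite mem_cat ts.
by move=> t tr; apply: xy; rewrite mem_cat tr orbT.
Qed.

Lemma step_set_preimage (i : interval R) :
  step_set (@I01_val R @^-1` [set` i]).
Proof.
split.
  exact: measurable_preimageT (@measurable_I01_val R) (measurable_itv i).
pose ends (b : itv_bound R) := if b is BSide _ t then [:: t] else [::].
case: i => l r; exists (ends l ++ ends r) => x y xy.
have xl : (l <= BLeft (I01_val x))%O = (l <= BLeft (I01_val y))%O.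
  case: l xy => [b t|b] xy; last by case: b xy.
  have [] := xy t; first by rewrite mem_cat mem_head.
  by case: b {xy}; rewrite !bnd_simp // !leNgt => _ ->.
have xr : (BRight (I01_val x) <= r)%O = (BRight (I01_val y) <= r)%O.
  case: r xy => [b t|b] xy; last by case: b xy.
  have [] := xy t; first by rewrite mem_cat mem_head orbT.
  by case: b {xy}; rewrite !bnd_simp // !leNgt => ->.
by rewrite /= !itv_boundlr xl xr.
Qed.

Lemma sigma_step_set : measurable `<=` <<s step_set >>.
Proof.
move=> _ [B mB <-]; rewrite setTI.
pose G B := <<s step_set >> (@I01_val R @^-1` B).
have : (@RGenInftyO.G R).-sigma.-measurable B.
  by rewrite -RGenInftyO.measurableE.
apply: (@smallest_sub _ _ _ G); last first.
  by move=> _ [x ->]; apply: sub_sigma_algebra; exact: step_set_preimage.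
split.
- by rewrite /G preimage_set0; exact: sigma_algebra0.
- by move=> A GA; rewrite /G setTD preimage_setC -setTD; exact: sigma_algebraCD.
- by move=> F GF; rewrite /G preimage_bigcup; exact: sigma_algebra_bigcup.
Qed.

Lemma measurable_I01_preimage B : measurable B ->
  measurable (@I01_val R @^-1` B).
Proof. exact: measurable_preimageT (@measurable_I01_val R). Qed.

Lemma I01_pointE (y : I01 R) : [set y] = @I01_val R @^-1` [set I01_val y].
Proof. by apply/seteqP; split=> [_ -> //|z /val_inj]. Qed.

Lemma prob_I01_point (y : I01 R) : prob (@lebesgue01 R) [set y] = 0.
Proof.
rewrite I01_pointE.
exact: (congr1 fine (uniform01_atomless (I01_val y))).
Qed.

Lemma prob_I01_itv (a b : R) : 0 <= a -> a < b -> b <= 1 ->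
  prob (@lebesgue01 R) (@I01_val R @^-1` `]a, b[%classic) = b - a.
Proof.
move=> a0 ab b1; have -> : prob (@lebesgue01 R) (@I01_val R @^-1` `]a, b[%classic) =
  prob (uniform01 R) `]a, b[ by [].
rewrite /prob uniform01E (_ : _ `&` _ = `]a, b[%classic).
  by rewrite lebesgue_measure_itv/= lte_fin ab.
apply/seteqP; split=> [t []//|t /[dup] abt]; split=> //.
move: abt; rewrite /= !in_itv/= => /andP[/ltW/(le_trans a0)-> /lt_le_trans].
by move/(_ _ b1) => ->.
Qed.

(** A set of positive measure contains a point that is neither 0 nor an endpoint;
    all points that are closer to it than the endpoints belong to the set. *)
Lemma fat_step_set A : step_set A -> 0 < prob (@lebesgue01 R) A -> fat A.
Proof.
move=> [mA [s sA]] A0.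
have [x Ax xs] : exists2 x, A x & I01_val x \notin 0 :: s.
  apply: contrapT => noA; move: A0; rewrite ltNge => /negP; apply.
  have cZ : countable [set` 0 :: s] by exact/finite_set_countable/finite_seq.
  have mZ : measurable [set` 0 :: s] by exact: countable_measurable.
  have <- : prob (@lebesgue01 R) (@I01_val R @^-1` [set` 0 :: s]) = 0.
    change (prob (uniform01 R) [set` 0 :: s] = 0).
    rewrite /prob uniform01E; have -> : lebesgue_measure
      ([set` 0 :: s] `&` `[0, 1[%classic) = 0%E; last by [].
    apply/eqP; rewrite eq_le measure_ge0 andbT.
    rewrite -(countable_lebesgue_measure0 cZ); apply: le_measure; rewrite ?inE//.
    by apply: measurableI => //; exact: measurable_itv.
  apply: prob_le => //; first exact: measurable_I01_preimage.
  by move=> x Ax; apply: contrapT => /negP nx; apply: noA; exists x.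
have [e e0 es] : exists2 e : R, 0 < e & forall t, t \in 0 :: s ->
    e <= `|t - I01_val x|.
  elim: (0 :: s) xs => [|t r ih]; first by exists 1.
  rewrite inE negb_or => /andP[xt /ih[e e0 er]].
  exists (Num.min e `|t - I01_val x|).
    by rewrite lt_min e0 normr_gt0 subr_eq0 eq_sym.
  by move=> u; rewrite inE ge_min => /predU1P[->|/er ->//]; rewrite lexx orbT.
have /andP[x0 x1] := I01_val_in x.
exists (I01_val x - e), (Num.min (I01_val x + e) 1); split.
- by have := es 0 (mem_head _ _); rewrite sub0r normrN ger0_norm// subr_ge0.
- by rewrite lt_min; apply/andP; split; lra.
- by rewrite ge_min lexx orbT.
move=> y /=; rewrite in_itv/= lt_min => /andP[xey /andP[yxe _]].
apply: sA Ax => t ts; have := es t; rewrite inE ts orbT => /(_ isT).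
have [tx|xt|->] := ltgtP t (I01_val x); last by rewrite subrr normr0; lra.
  rewrite distrC ger0_norm; last by lra.
  by move=> et; split; apply/esym; [|apply/negbTE; rewrite -leNgt]; lra.
rewrite ger0_norm; last by lra.
by move=> et; split; apply/esym; [apply/negbTE; rewrite -leNgt|]; lra.
Qed.

Lemma interval_preimageE (J : set (I01 R)) :
  @I01_val R @^-1` (@I01_val R @` J) = J.
Proof.
by apply/seteqP; split=> [y [z Jz /val_inj <-]//|y Jy]; exists y.
Qed.

Lemma measurable_interval01 J : @intervals01 R J -> measurable J.
Proof.
move=> /is_interval_measurable mJ; rewrite -(interval_preimageE J).
exact: measurable_I01_preimage.
Qed.

Lemma fat_interval01 J : @intervals01 R J -> 0 < prob (@lebesgue01 R) J -> fat J.
Proof.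
move=> itvJ J0.
have [x Jx] : J !=set0.
  by apply/set0P/eqP => J00; move: J0; rewrite J00 prob_set0 ltxx.
have [y Jy xy] : exists2 y, J y & y <> x.
  apply: contrapT => noy; move: J0; rewrite ltNge => /negP; apply.
  rewrite -(prob_I01_point x); apply: prob_le => //.
  - exact: measurable_interval01.
  - by rewrite I01_pointE; exact: measurable_I01_preimage.
  - by move=> y Jy; apply: contrapT => yx; apply: noy; exists y.
have fat_lt u v : J u -> J v -> I01_val u < I01_val v -> fat J.
  move=> Ju Jv uv; exists (I01_val u), (I01_val v); split => //.
  - by have /andP[] := I01_val_in u.
  - by have /andP[_ /ltW] := I01_val_in v.
  move=> z /=; rewrite in_itv/= => /andP[/ltW uz /ltW zv].
  rewrite -(interval_preimageE J); apply: (itvJ (I01_val u) (I01_val v)).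
  - by exists u.
  - by exists v.
  - by rewrite uz.
case: (ltgtP (I01_val x) (I01_val y)) => [|| /val_inj/esym//]; exact: fat_lt.
Qed.

Lemma open_measurable_I01 (U : set (I01 R)) : open U -> measurable U.
Proof.
move=> [V oV <-]; apply: measurable_I01_preimage; exact: open_measurable.
Qed.

Lemma fat_open (U : set (I01 R)) : open U -> U !=set0 -> fat U.
Proof.
move=> [V oV <-] [x Vx']; have {Vx'}Vx : V (I01_val x) by exact: Vx'.
have /nbhs_ballP[e /= e0 eV] := open_nbhs_nbhs (conj oV Vx).
have /andP[x0 x1] := I01_val_in x.
exists (I01_val x), (Num.min (I01_val x + e) 1); split => //.
- by rewrite lt_min x1 ltrDl e0.
- by rewrite ge_min lexx orbT.
move=> y /=; rewrite in_itv/= lt_min => /andP[xy /andP[ye _]].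
suff : V (I01_val y) by [].
by apply: eV; rewrite /ball/= distrC ger0_norm; lra.
Qed.

End step_sets.

(** * The realization *)

Section light_pair_lemmas.
Context d (X : measurableType d) (R : realType) (mu : probability X R).
Variables (T T' : X -> X).
Hypothesis TT' : inverse_measurable T T'.
Hypothesis T_mp : measure_preserving mu mu T.

Lemma light_pair_gt0 A B : measurable A -> measurable B ->
  light_pair mu T' A B -> exists N, forall n, (N <= n)%N ->
  (0 < mu ((iter n T @` A) `&` B))%E.
Proof.
move=> mA mB [c [c0 [N cN]]]; exists N => n /cN cn.
rewrite (image_iterE TT') probE ?lte_fin; first exact: lt_le_trans cn.
by apply: measurableI => //; exact: (measurable_iter_inverse TT').
Qed.

(** The measures are at least c from some time on, hence so are their infima over
    the later times. *)
Lemma light_pair_limn_einf A B : measurable A -> measurable B ->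
  light_pair mu T' A B ->
  (0 < limn_einf (fun n => mu ((iter n T @` A) `&` B)))%E.
Proof.
move=> mA mB [c [c0 [N cN]]]; apply: (@lt_le_trans _ _ c%:E); first by rewrite lte_fin.
rewrite limn_einf_lim; apply: lime_ge; first exact: is_cvg_einfs.
exists N => // n /= Nn; apply: le_ereal_inf_tmp => _ [k /= nk <-].
rewrite (image_iterE TT') probE; last first.
  by apply: measurableI => //; exact: (measurable_iter_inverse TT').
by rewrite lee_fin cN// (leq_trans Nn).
Qed.

Lemma light_pair_sub N A B A' B' : measurable N -> prob mu N = 0 ->
  measurable A -> measurable B -> measurable A' -> measurable B' ->
  A `<=` A' `|` N -> B `<=` B' `|` N ->
  light_pair mu T' A B -> light_pair mu T' A' B'.
Proof.
move=> mN N0 mA mB mA' mB' AN BN [c [c0 [M cM]]].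
have mpre' n C : measurable C -> measurable (iter n T' @^-1` C).
  exact: (measurable_iter_inverse TT').
exists c; split => //; exists M => n /cM cn; apply: (le_trans cn).
have N0' : prob mu (iter n T' @^-1` N `|` N) = 0.
  apply/eqP; rewrite eq_le prob_ge0 andbT.
  apply: le_trans (probU_le mu (mpre' n _ mN) mN) _.
  by rewrite (prob_iter_inverse TT' T_mp)// N0 addr0.
rewrite -[leRHS]addr0 -N0'; apply: prob_subD.
- by apply: measurableI => //; exact: mpre'.
- by apply: measurableI => //; exact: mpre'.
- by apply: measurableU => //; exact: mpre'.
by move=> x [/= /AN [] ? /BN [] ?]; tauto.
Qed.

End light_pair_lemmas.

Lemma nontrivial_set d (X : measurableType d) (R : realType)
    (mu : probability X R) : ~ trivial_space mu ->
  exists A, [/\ measurable A, 0 < prob mu A & prob mu A < 1].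
Proof.
move=> nt; apply: contrapT => noA; apply: nt => A mA; apply: contrapT => /not_orP.
rewrite probE// => -[A0 A1]; apply: noA; exists A; split => //.
  by rewrite lt_neqAle prob_ge0 andbT; apply/eqP => A0'; apply: A0; rewrite -A0'.
by rewrite lt_neqAle prob_le1// andbT; apply/eqP => A1'; apply: A1; rewrite A1'.
Qed.

(** A point of positive mass would not return to itself, hence would have
    infinitely many disjoint images of the same mass. *)
Lemma escape_atomless d (X : measurableType d) (R : realType)
    (mu : probability X R) (T T' : X -> X) (x : X) :
  inverse_measurable T T' -> measure_preserving mu mu T ->
  ~ trivial_space mu ->
  (forall A, measurable A -> 0 < prob mu A -> prob mu A < 1 ->
    exists c : R, 0 < c /\ exists N, forall n, (N <= n)%N ->
      c <= prob mu (iter n T' @^-1` A `\` A)) ->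
  measurable [set x] -> prob mu [set x] = 0.
Proof.
move=> TT' T_mp nt escape mx; apply/eqP; rewrite eq_le prob_ge0 andbT leNgt.
apply/negP => x0.
have x1 : prob mu [set x] < 1.
  have [A [mA A0 A1]] := nontrivial_set nt.
  rewrite lt_neqAle prob_le1// andbT; apply/eqP => x1.
  have := probDI mu mx mA; have [Ax|nAx] := pselect (A x).
    by have := prob_le mu mx mA (fun y yx => eq_ind_r A Ax yx); rewrite x1; lra.
  have : [set x] `<=` ~` A by move=> _ ->.
  by move/(prob_le mu mx (measurableC mA)); rewrite probC// x1; lra.
have [c [c0 [N cN]]] := escape _ mx x0 x1.
have aperiodic n : (0 < n)%N -> iter n T x <> x.
  move=> n0 nx; have nkx k : iter (k * n) T x = x.
    by elim: k => // k ih; rewrite mulSn iterD ih.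
  have := cN (N * n)%N; rewrite leq_pmulr// => /(_ isT).
  rewrite (_ : _ `\` _ = set0) ?prob_set0 ?leNgt ?c0//.
  apply/seteqP; split=> // y [/= yx]; apply.
  by rewrite /= -(iterK_direct TT' (N * n) y) yx nkx.
pose F n := iter n T @^-1` [set x].
have mF n : measurable (F n) by exact: (measurable_iter TT').
have Flt m n y : (m < n)%N -> F m y -> ~ F n y.
  rewrite /F /= => mn my ny; apply: (@aperiodic (n - m)%N).
    by rewrite subn_gt0.
  by rewrite -{1}my -iterD subnK// ltnW.
have tF : trivIset setT F.
  move=> m n _ _ [y [Fm Fn]]; case: (ltngtP m n) => // mn.
    by case: (Flt _ _ _ mn Fm Fn).
  by case: (Flt _ _ _ mn Fn Fm).
have [k] := natSinv_lt x0; rewrite invf_plt ?posrE// => xk.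
have mS : measurable (\big[setU/set0]_(i < k.+1) F i) by exact: bigsetU_measurable.
have := prob_le1 mu mS; rewrite prob_bigsetU// (eq_bigr (fun=> prob mu [set x])).
  rewrite sumr_const card_ord -mulr_natr leNgt => /negP; apply.
  by rewrite -ltr_pdivrMl// mulr1.
by move=> i _; rewrite (prob_iter TT' T_mp).
Qed.

Lemma itv_contains_cell (R : realType) (a b : R) : a < b ->
  exists i j, cell i j `<=` (`]a, b[%classic : set R).
Proof.
move=> ab; apply: open_contains_cell; first exact: interval_open.
by exists ((a + b) / 2); rewrite /= in_itv/=; apply/andP; split; lra.
Qed.

(** The disjoint light pairs are placed in all pairs of cells.  The inverse image
    of an interval of [0, 1[ under the distribution function contains an interval
    of the line, hence a cell; therefore psi maps to any two such intervals the
    two members of some light pair, up to a null set. *)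
Lemma lightly_mixing_realization d (X : measurableType d) (R : realType)
    (mu : probability X R) (T T' : X -> X) :
  separable_space mu -> standard_Borel X R -> ~ trivial_space mu ->
  inverse_measurable T T' -> measure_preserving mu mu T ->
  mildly_mixing mu T ->
  exists (psi : X -> I01 R) (phi : I01 R -> X),
    [/\ inverse_measurable psi phi, measure_preserving mu (@lebesgue01 R) psi &
    forall A B, measurable A -> measurable B -> fat A -> fat B ->
      light_pair mu T' (psi @^-1` A) (psi @^-1` B)].
Proof.
move=> mu_sep [f [mf fi fm]] nt TT' T_mp mild.
have escape A := @mild_mixing_escape _ _ _ mu T T' A mu_sep TT' T_mp mild.
have [A0 [mA0 A00 A01]] := nontrivial_set nt.
have [P [mP tP lightP]] := disjoint_light_pairs TT' T_mp
  (fun e e0 => small_light_pair TT' T_mp escape mA0 A00 A01 e0).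
(* every pair of cells occurs, at two consecutive indices m.*2 and m.*2.+1 *)
pose cells k : (int * nat) * (int * nat) := odflt ((0, 0%N), (0, 0%N)) (unpickle k).
pose c k := if odd k then (cells k./2).2 else (cells k./2).1.
have [g [g_emb gP]] := embedding_into_cells (fun k => (c k).1) (fun k => (c k).2)
  (And3 mf fi fm : embedding f) mP tP.
have [mg gi gm] := g_emb.
have atomless t : prob mu (g @^-1` [set t]) = 0.
  have [[x gx]|not] := pselect (exists x, g x = t); last first.
    rewrite (_ : _ @^-1` _ = set0) ?prob_set0//.
    by apply/seteqP; split=> // x gx; apply: not; exists x.
  have xE : g @^-1` [set t] = [set x].
    by apply/seteqP; split=> [y /= gy|_ -> //]; apply: gi; rewrite gy.
  rewrite xE; apply: (escape_atomless TT' T_mp nt escape).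
  by rewrite -xE; exact: measurable_preimageT.
have [psi [phi [psi_inv psi_mp [N [mN N0] psiE]]]] :=
  atomless_isomorphism g_emb mg atomless.
have [_ _ mpsi _] := psi_inv.
exists psi, phi; split => //.
pose nu := law mu mg; have nu0 t : prob nu [set t] = 0 by exact: atomless.
(* a cell between the quantiles at the thirds of ]a, b[ is mapped into ]a, b[ *)
have cell_fat A : fat A -> exists i j, forall k, c k = (i, j) ->
    P k `<=` psi @^-1` A `|` N.
  move=> [a [b [a0 ab b1 abA]]].
  pose s := a + (b - a) / 3; pose t := a + (b - a) * 2 / 3.
  have s01 : 0 < s < 1 by rewrite /s; apply/andP; split; lra.
  have t01 : 0 < t < 1 by rewrite /t; apply/andP; split; lra.
  have st : quantile nu s < quantile nu t.
    apply: (quantile_incr nu0); rewrite ?in_itv//= /s /t; lra.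
  have [i [j ijst]] := itv_contains_cell st.
  exists i, j => k ck x Px; have [|nNx] := pselect (N x); [by right|left].
  have := gP k x Px; rewrite ck => /ijst; rewrite /= in_itv/= => /andP[sg gt].
  apply: abA; rewrite /= psiE// in_itv/= -/nu.
  have /andP[s0 s1] := s01; have /andP[t0 t1] := t01.
  have := cumulative_le nu (ltW gt); rewrite (cumulative_quantile nu0 t0 t1).
  have := ltW sg; rewrite (quantile_le nu0 s0 s1).
  by rewrite /s /t => ? ?; apply/andP; split; lra.
move=> A B mA mB /cell_fat[i [j ijP]] /cell_fat[k [l klP]].
have half1 n : n.*2.+1./2 = n by rewrite /= uphalf_double.
pose m := pickle ((i, j), (k, l)).
have cm : cells m = ((i, j), (k, l)) by rewrite /cells pickleK.
apply: (light_pair_sub TT' T_mp mN N0 (mP m.*2) (mP m.*2.+1) _ _ _ _ (lightP m)).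
- exact: measurable_preimageT.
- exact: measurable_preimageT.
- by apply: ijP; rewrite /c odd_double doubleK cm.
- by apply: klP; rewrite /c oddS odd_double half1 cm.
Qed.

Section realization.
Context d (X : measurableType d) (R : realType) (mu : probability X R).
Variables (T T' : X -> X) (psi : X -> I01 R) (phi : I01 R -> X).
Hypothesis TT' : inverse_measurable T T'.
Hypothesis T_mp : measure_preserving mu mu T.
Hypothesis psi_inv : inverse_measurable psi phi.
Hypothesis psi_mp : measure_preserving mu (@lebesgue01 R) psi.
Hypothesis light : forall A B, measurable A -> measurable B -> fat A -> fat B ->
  light_pair mu T' (psi @^-1` A) (psi @^-1` B).

Let psiK : cancel psi phi. Proof. by case: psi_inv. Qed.
Let phiK : cancel phi psi. Proof. by case: psi_inv. Qed.
Let mpsi : measurable_fun setT psi. Proof. by case: psi_inv. Qed.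
Let mphi : measurable_fun setT phi. Proof. by case: psi_inv. Qed.

Local Notation S := (psi \o T \o phi).
Local Notation S' := (psi \o T' \o phi).

Lemma conjugate_inverse : inverse_measurable S S'.
Proof.
have [TK T'K mT mT'] := TT'; split.
- by move=> y /=; rewrite psiK TK phiK.
- by move=> y /=; rewrite psiK T'K phiK.
- apply: measurableT_comp => //; exact: measurableT_comp.
- apply: measurableT_comp => //; exact: measurableT_comp.
Qed.

Lemma conjugate_mp : measure_preserving (@lebesgue01 R) (@lebesgue01 R) S.
Proof.
move=> A mA; have [_ _ mS _] := conjugate_inverse; have [_ _ mT _] := TT'.
rewrite -!psi_mp//; last exact: measurable_preimageT.
have -> : psi @^-1` (S @^-1` A) = T @^-1` (psi @^-1` A).
  by apply/seteqP; split=> x /=; rewrite psiK.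
by rewrite T_mp//; exact: measurable_preimageT.
Qed.

Lemma iter_conjugate n x : iter n S' (psi x) = psi (iter n T' x).
Proof. by elim: n => //= n ->; rewrite psiK. Qed.

Lemma light_pair_conjugate A B : measurable A -> measurable B ->
  fat A -> fat B -> light_pair (@lebesgue01 R) S' A B.
Proof.
move=> mA mB fA fB; have [c [c0 [N cN]]] := light mA mB fA fB.
exists c; split => //; exists N => n /cN; congr (_ <= _).
rewrite /prob -psi_mp; last first.
  apply: measurableI => //; exact: (measurable_iter_inverse conjugate_inverse).
congr (fine (mu _)); apply/seteqP.
by split=> x [] /=; rewrite iter_conjugate.
Qed.

Lemma mildly_mixing_conjugate : mildly_mixing mu T ->
  mildly_mixing (@lebesgue01 R) S.
Proof.
move=> mild d' Y nu V nu_sep V_mp [p [mp p_mp [N [mN N0 Np]]]].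
apply: mild => //; exists (p \o psi); split.
- exact: measurableT_comp.
- move=> A mA; rewrite -p_mp// -psi_mp//; exact: measurable_preimageT.
exists (psi @^-1` N); split; first exact: measurable_preimageT.
  by rewrite psi_mp.
move=> x nx; apply: Np => /= E; apply: nx; rewrite /= -E /=.
by rewrite psiK.
Qed.

End realization.

Theorem mainTheorem11 (R : realType) (d : measure_display)
  (X : measurableType d) (mu : probability X R) (T : X -> X)
  (mu_separable : separable_space mu)
  (X_standard : standard_Borel X R)
  (mu_nontrivial : ~ trivial_space mu)
  (T_mp : mp_transformation mu T)
  (T_mild : mildly_mixing mu T) :
  exists (C : set (set X)) (phi : I01 R -> X) (psi : X -> I01 R),
    [/\ [/\ set_algebra C, dense_family mu C & lightly_mixing_on mu C T],
        measure_isomorphism (@lebesgue01 R) mu phi psi,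
        (forall J : set (I01 R), @intervals01 R J -> (0 < @lebesgue01 R J)%E ->
          exists A, [/\ C A, (0 < mu A)%E & A `<=` phi @` J]) &
        let S := psi \o T \o phi in
        [/\ mp_transformation (@lebesgue01 R) S,
            mildly_mixing (@lebesgue01 R) S,
            lightly_mixing_on (@lebesgue01 R) (@intervals01 R) S &
            topologically_mixing01 S]].
Proof.
have [[T' TT'] mpT] := T_mp.
have [psi [phi [psi_inv psi_mp light]]] := lightly_mixing_realization
  mu_separable X_standard mu_nontrivial TT' mpT T_mild.
have [psiK phiK mpsi mphi] := psi_inv.
have prob_psi A : measurable A -> prob mu (psi @^-1` A) = prob (@lebesgue01 R) A.
  by move=> mA; congr fine; exact: psi_mp.
have image_phi A : phi @` A = psi @^-1` A.
  apply/seteqP; split=> [_ [y Ay <-]|x Ax]; first by rewrite /= phiK.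
  by exists (psi x).
pose C := [set psi @^-1` A | A in @step_set R].
have Cm : C `<=` measurable.
  by move=> _ [A [mA _] <-]; exact: measurable_preimageT.
have C0 : C set0 by exists set0; [exact: step_set0|rewrite preimage_set0].
have CC : setC_closed C.
  by move=> _ [A sA <-]; exists (~` A); [exact: step_setC|rewrite preimage_setC].
have CU : setU_closed C.
  move=> _ _ [A sA <-] [B sB <-]; exists (A `|` B); first exact: step_setU.
  by rewrite preimage_setU.
have Cgen : measurable `<=` <<s C >>.
  move=> A mA; have -> : A = psi @^-1` (phi @^-1` A).
    by apply/seteqP; split=> x /=; rewrite psiK.
  have : <<s @step_set R >> (phi @^-1` A).
    by apply: sigma_step_set; exact: measurable_preimageT.
  apply: (@smallest_sub _ _ _ [set B | <<s C >> (psi @^-1` B)]); last first.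
    by move=> B sB; apply: sub_sigma_algebra; exists B.
  split=> /=.
  - by rewrite preimage_set0; exact: sigma_algebra0.
  - by move=> B GB; rewrite setTD preimage_setC -setTD; exact: sigma_algebraCD.
  - by move=> F GF; rewrite preimage_bigcup; exact: sigma_algebra_bigcup.
have S_inv := conjugate_inverse TT' psi_inv.
have S_light A B : measurable A -> measurable B -> fat A -> fat B ->
    light_pair (@lebesgue01 R) (psi \o T' \o phi) A B.
  exact: (light_pair_conjugate TT' psi_inv psi_mp light).
have pos A : measurable A -> (0 < @lebesgue01 R A)%E -> 0 < prob (@lebesgue01 R) A.
  by move=> mA; rewrite probE.
exists C, phi, psi; split.
- split.
  + split; last by rewrite -setC0; exact: CC.
    split => // A B CA CB.
    by rewrite setDE -[A `&` _]setCK setCI setCK; apply: (CC); apply: CU => //; exact: CC.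
  + split => // A mA e e0; have [_ /(_ e e0)[B CB AB]] :=
      sigma_approximable mu Cm C0 CC CU (Cgen _ mA).
    exists B => //; rewrite probE ?lte_fin// setY_def.
    by apply: measurableU; apply: measurableD => //; exact: Cm.
  + move=> _ _ [A sA <-] [B sB <-] A0 B0.
    have mA := sA.1; have mB := sB.1; rewrite !psi_mp// in A0 B0.
    apply: (light_pair_limn_einf TT'); [exact: measurable_preimageT..|].
    by apply: light => //; apply: fat_step_set => //; exact: pos.
- split; last first.
    move=> A mA; rewrite -psi_mp; last exact: measurable_preimageT.
    by congr (mu _); apply/seteqP; split=> x /=; rewrite psiK.
  by split.
- move=> J itvJ J0; have mJ := measurable_interval01 itvJ.
  have [a [b [a0 ab b1 abJ]]] := fat_interval01 itvJ (pos _ mJ J0).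
  have mab := measurable_I01_preimage (measurable_itv `]a, b[).
  exists (psi @^-1` (@I01_val R @^-1` `]a, b[%classic)); split.
  + by exists (@I01_val R @^-1` `]a, b[%classic) => //; exact: step_set_preimage.
  + by rewrite psi_mp// probE// lte_fin prob_I01_itv// subr_gt0.
  + by rewrite image_phi => x /abJ.
split.
- by split; [exists (psi \o T' \o phi)|exact: (conjugate_mp TT' mpT psi_inv psi_mp)].
- exact: (mildly_mixing_conjugate psi_inv psi_mp).
- move=> J K itvJ itvK J0 K0.
  have mJ := measurable_interval01 itvJ; have mK := measurable_interval01 itvK.
  apply: (light_pair_limn_einf S_inv) => //; apply: S_light => //.
    exact: fat_interval01 itvJ (pos _ mJ J0).
  exact: fat_interval01 itvK (pos _ mK K0).
- move=> U V oU oV U0 V0.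
  have mU := open_measurable_I01 oU; have mV := open_measurable_I01 oV.
  apply: (light_pair_gt0 S_inv) => //; apply: S_light => //; exact: fat_open.
Qed.
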